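(* Let $\varepsilon>0$, $f\in\mathbb R[x]_{2d}$ and $g_i\in\mathbb R[x]_{2d_i}$ for $i=0,\dots,m$, with $g_0=1$, and let $k\ge\max\{d,d_0,\dots,d_m\}$. Fix $r\in(0,1)$. Assume there exist indices $i_1,i_2\in\{1,\dots,m\}$ and $i_\alpha\in\{1,\dots,m\}$ for each $\alpha\in\{0,1\}^n\setminus\{0\}$ such that - $g_{i_j}=c_j[r^j-(x_1+\dots+x_n)^j]$ with $c_j>0$, for $j=1,2$; - $g_{i_\alpha}=x^\alpha$ for every $\alpha\in\{0,1\}^n\setminus\{0\}$. Let $S(g)=\{x\in\mathbb R^n: g_i(x)\ge0,\ i=1,\dots,m\}$, and let $\lambda_k$ be the value of the order-$k$ sum-of-squares relaxation of $\inf_{x\in S(g)}f(x)$. Suppose that: (a) there exist $\underline\lambda\in\mathbb R$ and a positive measure $\mu$ supported on $S(g)$ with $\underline\lambda\le\lambda_k$ and $\int(f-\underline\lambda)\,d\mu\,/\,\lambda_{\min}(D_k(g\mu))\le 1$; (b) $\|g_i\|_{\ell_1}\le1$ for $i=1,\dots,m$. Assume strong duality holds for the order-$k$ sum-of-squares and moment relaxations. Let $\lambda_k^{(\varepsilon)}$ be the value returned by the algorithm CON (described in the context), run with $\varepsilon$, $\underline\lambda$ and a point $a\in S(g)$. Then $$0\le \lambda_k^{(\varepsilon)}-\lambda_k\le\varepsilon\left(2+\frac{r}{1-r}\right).$$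
   Context: Notation. $\mathbb N^n_t=\{\alpha\in\mathbb N^n:|\alpha|\le t\}$; $\mathbb R[x]_t$: real polynomials in $x=(x_1,\dots,x_n)$ of degree at most $t$; $f=\sum f_\alpha x^\alpha$, $g_i=\sum g_{i,\alpha}x^\alpha$; $d=\lceil\deg(f)/2\rceil$, $d_i=\lceil\deg(g_i)/2\rceil$; $\|p\|_{\ell_1}$ is the sum of absolute values of the coefficients of $p$; $v_t=(x^\alpha)_{\alpha\in\mathbb N^n_t}$; $\mathbb S^N$: real symmetric $N\times N$ matrices. For $y=(y_\alpha)_{\alpha\in\mathbb N^n_{2k}}$: $M_k(y)=(y_{\alpha+\beta})_{\alpha,\beta\in\mathbb N^n_k}$; $M_{k-d_i}(g_iy)=(\sum_\gamma g_{i,\gamma}y_{\alpha+\beta+\gamma})_{\alpha,\beta\in\mathbb N^n_{k-d_i}}$; $L_y(\sum p_\alpha x^\alpha)=\sum p_\alpha y_\alpha$; $D_k(gy)=\operatorname{diag}((M_{k-d_i}(g_iy))_{i=0,\dots,m})$. For a measure $\mu$ with finite moments, $D_k(g\mu)=D_k(gy)$ with $y_\alpha=\int x^\alpha d\mu$. $\lambda_{\min}(\cdot)$ of a matrix is its smallest eigenvalue (implicitly positive in (a)). Relaxations. SOS: $\lambda_k=\sup\{\lambda:\ \lambda\in\mathbb R,\ G=\operatorname{diag}(G_0,\dots,G_m)\succeq0,\ f-\lambda=\sum_{i=0}^mg_iv_{k-d_i}^\top G_iv_{k-d_i}\}$. Moment: $\tau_k=\min\{L_y(f): y=(y_\alpha)_{\alpha\in\mathbb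 N^n_{2k}},\ y_0=1,\ M_k(y)\succeq0,\ M_{k-d_i}(g_iy)\succeq0,\ i=1,\dots,m\}$. Strong duality means $\lambda_k=\tau_k$ and both problems have optimal solutions. Hamiltonian updates HU. Input: $\varepsilon>0$, $A'_1,\dots,A'_{M'}\in\mathbb S^N$, $b'_1,\dots,b'_{M'}\in\mathbb R$ (encoding: find $X\succeq0$ with $\operatorname{tr}X=1$, $\operatorname{tr}(A'_jX)\le b'_j$ for all $j$). Set $W^{(1)}=I_N$ and $T'=\lceil 16\log(N)/\varepsilon^2\rceil$. For $t=1,\dots,T'$: set $P^{(t)}=W^{(t)}/\operatorname{tr}(W^{(t)})$; if some $j^{(t)}$ satisfies $\operatorname{tr}(A'_{j^{(t)}}P^{(t)})>b'_{j^{(t)}}+\varepsilon$, choose one and set $M^{(t)}=\frac12(I_N-A'_{j^{(t)}})$; otherwise stop with output $\eta=1$. Set $W^{(t+1)}=\exp\big(\frac{\varepsilon}{4}\sum_{s=1}^tM^{(s)}\big)$. If the loop completes, output $\eta=0$. Binary search BS. Input: $C,A_1,\dots,A_M\in\mathbb S^N$, $b\in\mathbb R^M$, reals $\lambda_{\min}<\lambda_{\max}$, $\varepsilon>0$. Set $\underline\lambda_0=\lambda_{\min}$, $\overline\lambda_0=\lambda_{\max}$, $T=\lceil\log_2((\lambda_{\max}-\lambda_{\min})/\varepsilon)\rceil$ (no iterations if $T\le 0$). For $t=0,\dots,T-1$: let $\lambda_t=(\underline\lambda_t+\overline\lambda_t)/2$; run HU with accuracy $\varepsilon$ on the constraints $\operatorname{tr}(A_iX)\le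 b_i$, $\operatorname{tr}(-A_iX)\le -b_i$ ($i=1,\dots,M$), $\operatorname{tr}(CX)\le\lambda_t$; if $\eta=0$ set $(\underline\lambda_{t+1},\overline\lambda_{t+1})=(\lambda_t,\overline\lambda_t)$, if $\eta=1$ set $(\underline\lambda_{t+1},\overline\lambda_{t+1})=(\underline\lambda_t,\lambda_t)$. Output: the final lower value $\underline\lambda_T$. Algorithm CON. For $i=0,\dots,m$ and $\eta\in\mathbb N^n$, let $B_i^{(\eta)}$ be the matrix indexed by $\mathbb N^n_{k-d_i}$ with $(\alpha,\beta)$-entry $1$ if $\alpha+\beta=\eta$ and $0$ otherwise. For $\gamma\in\mathbb N^n_{2k}$ put $B_g^{(\gamma)}=\operatorname{diag}\big(\big(\sum_{\zeta\in\mathbb N^n_{2d_i},\,\gamma-\zeta\in\mathbb N^n}g_{i,\zeta}B_i^{(\gamma-\zeta)}\big)_{i=0,\dots,m}\big)$. Enumerate $\mathbb N^n_{2k}=\{\gamma_0=0,\gamma_1,\dots,\gamma_M\}$, $M=\binom{n+2k}{n}-1$. Put $C=\operatorname{diag}(B_g^{(0)},0)$, $A_i=\operatorname{diag}(B_g^{(\gamma_i)},0)$, $b_i=f_{\gamma_i}$ ($i=1,\dots,M$), of size $N=1+\sum_{i=0}^m\binom{n+k-d_i}{n}$; $\lambda_{\min}=f_0-f(a)$, $\lambda_{\max}=f_0-\underline\lambda$ (with $\lambda_{\min}<\lambda_{\max}$ as required by BS). Run BS and return $\lambda_k^{(\varepsilon)}=f_0-\underline\lambda_T$. *)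

(* Defs.v *)
From HB Require Import structures.
From mathcomp Require Import all_boot all_order all_algebra.
From mathcomp Require Import all_classical all_reals all_analysis.
(* The notations of mpoly clash with those of MathComp-Analysis. *)
From mathcomp Require Import -(notations) mpoly.

Set Implicit Arguments.
Unset Strict Implicit.
Unset Printing Implicit Defensive.

Import Order.TTheory GRing.Theory Num.Theory.
Import numFieldNormedType.Exports.

Local Open Scope classical_set_scope.
Local Open Scope ring_scope.

(* The finite type N^n_t of exponents alpha with |alpha| <= t. *)
Notation mons n t := (bmultinom n t.+1).

Definition exponent n t (a : 'I_#|{: mons n t}|) : multinom n :=
  bmnm (enum_val a).

Section Matrices.
Variable R : realType.

Definition psd N (A : 'M[R]_N) : Prop :=
  A^T = A /\ forall v : 'cV[R]_N, 0 <= (v^T *m A *m v) 0 0.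

(* Smallest eigenvalue: the infimum is attained for symmetric A and N > 0. *)
Definition lambda_min N (A : 'M[R]_N) : R := inf [set l | eigenvalue A l].

Definition expm N (A : 'M[R]_N) : 'M[R]_N :=
  limn (series (fun j => (j`!%:R)^-1 *: A ^+ j)).

End Matrices.

Section Polynomials.
Variables (R : realType) (n : nat).
Implicit Types p : mpoly n R.

(* ceil(deg p / 2); msize p is 1 + deg p, and the zero polynomial gets 0. *)
Definition hdeg p : nat := uphalf (msize p).-1.

Definition l1norm p : R := \sum_(al <- msupp p) `|mcoeff al p|.

Definition vmon t : 'cV[mpoly n R]_#|{: mons n t}| :=
  \col_j mpolyX R (exponent j).

(* Truncated sequences (y_al)_{|al| <= 2k} are represented by total functions
   y : multinom n -> R; only the values of degree at most 2k are ever used by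
   the order-k relaxation. *)
Definition riesz (y : multinom n -> R) p : R :=
  \sum_(al <- msupp p) mcoeff al p * y al.

Definition moment_mx t (y : multinom n -> R) : 'M[R]_#|{: mons n t}| :=
  \matrix_(a, b) y (mnm_add (exponent a) (exponent b)).

Definition localizing_mx t p (y : multinom n -> R) : 'M[R]_#|{: mons n t}| :=
  \matrix_(a, b) \sum_(ga <- msupp p)
    mcoeff ga p * y (mnm_add (mnm_add (exponent a) (exponent b)) ga).

(* The 0/1 matrix B^(eta) indexed by N^n_t. *)
Definition hankel_unit t (eta : multinom n) : 'M[R]_#|{: mons n t}| :=
  \matrix_(a, b) (mnm_add (exponent a) (exponent b) == eta)%:R.

Definition moments (mu : {measure set (n.-tuple R) -> \bar R})
    (al : multinom n) : R :=
  \int[mu]_x meval (tnth x) (mpolyX R al).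

End Polynomials.

Section Relaxations.
Variables (R : realType) (n m : nat).
Variables (f : mpoly n R) (g : 'I_m.+1 -> mpoly n R) (k : nat).

Definition feasible_set : set (n.-tuple R) :=
  [set x | forall i, i != ord0 -> 0 <= meval (tnth x) (g i)].

Definition bsize (i : 'I_m.+1) : nat := #|{: mons n (k - hdeg (g i))}|.

Definition sos_feasible (l : R) (G : forall i, 'M[R]_(bsize i)) : Prop :=
  psd (\mxdiag_(i < m.+1) G i) /\
  f - @mpolyC n R l =
    \sum_(i < m.+1) g i *
      ((vmon R n (k - hdeg (g i)))^T *m map_mx (@mpolyC n R) (G i)
         *m vmon R n (k - hdeg (g i))) 0 0.

Definition sos_value : \bar R :=
  ereal_sup [set l%:E | l in [set l | exists G, sos_feasible l G]].

Definition moment_feasible (y : multinom n -> R) : Prop :=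
  [/\ y (mnm0 (n := n)) = 1, psd (moment_mx k y) &
      forall i, i != ord0 -> psd (localizing_mx (k - hdeg (g i)) (g i) y)].

Definition moment_value : \bar R :=
  ereal_inf [set (riesz y f)%:E | y in moment_feasible].

Definition strong_duality : Prop :=
  [/\ sos_value = moment_value,
      exists l G, sos_feasible l G /\ l%:E = sos_value &
      exists y, moment_feasible y /\ (riesz y f)%:E = moment_value].

Definition Dmx (y : multinom n -> R) : 'M[R]_(\sum_(i < m.+1) bsize i) :=
  \mxdiag_(i < m.+1) localizing_mx (k - hdeg (g i)) (g i) y.

End Relaxations.

Section Algorithms.
Variable R : realType.

Definition ceil_nat (x : R) : nat := absz (Num.max 0 (Num.ceil x)).

(* The choice of a violated constraint in Hamiltonian updates is free, so the
   algorithms are given as relations between inputs and possible outputs; the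
   outputs eta = 1, 0 are true, false. In HU_from T S W eta, T is the number of
   rounds left, S the sum of the matrices M^(s) of the previous rounds and W the
   current W^(t). A constraint tr(A' X) <= b' is the pair (A', b'). *)
Section HamiltonianUpdates.
Variables (N : nat) (eps : R) (cs : seq ('M[R]_N * R)).

Inductive HU_from : nat -> 'M[R]_N -> 'M[R]_N -> bool -> Prop :=
| HU_completed S W : HU_from 0 S W false
| HU_stop T S W of
    (forall c, c \in cs -> \tr (c.1 *m ((\tr W)^-1 *: W)) <= c.2 + eps) :
    HU_from T.+1 S W true
| HU_update T S W c eta of
    c \in cs &
    c.2 + eps < \tr (c.1 *m ((\tr W)^-1 *: W)) &
    HU_from T (S + 2^-1 *: (1%:M - c.1))
      (expm ((eps / 4) *: (S + 2^-1 *: (1%:M - c.1)))) eta :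
    HU_from T.+1 S W eta.

Definition HU (eta : bool) : Prop :=
  HU_from (ceil_nat (16 * ln N%:R / eps ^+ 2)) 0 1%:M eta.

End HamiltonianUpdates.

Section BinarySearch.
Variables (N : nat) (eps : R) (C : 'M[R]_N) (Ab : seq ('M[R]_N * R)).

Definition BS_constraints (l : R) : seq ('M[R]_N * R) :=
  Ab ++ [seq (- c.1, - c.2) | c <- Ab] ++ [:: (C, l)].

(* BS_from T lo hi out: T rounds left, current bounds lo and hi, output out. *)
Inductive BS_from : nat -> R -> R -> R -> Prop :=
| BS_done lo hi : BS_from 0 lo hi lo
| BS_round T lo hi eta out of
    HU eps (BS_constraints ((lo + hi) / 2)) eta &
    BS_from T (if eta then lo else (lo + hi) / 2)
              (if eta then (lo + hi) / 2 else hi) out :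
    BS_from T.+1 lo hi out.

Definition BS (lmin lmax out : R) : Prop :=
  BS_from (ceil_nat (ln ((lmax - lmin) / eps) / ln 2)) lmin lmax out.

End BinarySearch.

Section CON.
Variables (n m : nat) (f : mpoly n R) (g : 'I_m.+1 -> mpoly n R) (k : nat).

Definition Bg (ga : multinom n) : 'M[R]_(\sum_(i < m.+1) bsize g k i) :=
  \mxdiag_(i < m.+1)
    \sum_(ze : mons n (2 * hdeg (g i)) | lem ze ga)
      mcoeff ze (g i) *: hankel_unit R (k - hdeg (g i)) (mnm_sub ga ze).

Definition CON_mx (ga : multinom n) : 'M[R]_(\sum_(i < m.+1) bsize g k i + 1) :=
  block_mx (Bg ga) 0 0 0.

Definition CON_constraints :
    seq ('M[R]_(\sum_(i < m.+1) bsize g k i + 1) * R) :=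
  [seq (CON_mx (bmnm ga), mcoeff ga f)
     | ga <- enum {: mons n (2 * k)} & bmnm ga != mnm0].

Definition CON_min (a : n.-tuple R) : R := mcoeff mnm0 f - meval (tnth a) f.
Definition CON_max (lam : R) : R := mcoeff mnm0 f - lam.

(* res is a possible return value of the algorithm run with eps, lam and a. *)
Definition CON (eps lam : R) (a : n.-tuple R) (res : R) : Prop :=
  exists2 out,
    BS eps (CON_mx mnm0) CON_constraints (CON_min a) (CON_max lam) out &
    res = mcoeff mnm0 f - out.

End CON.
End Algorithms.

(* Main.v *)
(* An optimal sum-of-squares certificate G has trace at most 1 by (a), since
   lambda_min(D_k(g mu)) tr G <= tr(G D_k(g mu)) = \int (f - lambda_k) dmu; padded
   with a slack entry it is a density matrix feasible for the constraints of
   every round of the binary search whose level is at least f_0 - lambda_k.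
   Hamiltonian updates never reject a feasible instance: for a feasible X the
   free energy ln tr exp(eta S) - eta tr(S X) starts at ln N, stays nonnegative
   and drops by more than eps^2/16 in each round. Hence the lower end of the
   search interval never exceeds f_0 - lambda_k. Conversely, an accepted level
   comes with a density matrix P satisfying all constraints up to eps, and
   pairing P with D_k(g y) for an optimal moment sequence y shows that the level
   is at least f_0 - lambda_k - eps (1 + sum_(ga <> 0) |y_ga|). The constraints
   x^alpha >= 0 make y nonnegative, and r - s, r^2 - s^2 with s = x_1 + ... + x_n
   give L_y(s^t) <= r^t, so that this sum is at most r/(1-r). *)

Require Import Defs.
From HB Require Import structures.
From mathcomp Require Import all_boot all_order all_algebra.
From mathcomp Require Import all_classical all_reals all_analysis.
From mathcomp Require Import -(notations) mpoly.
From mathcomp Require Import -(notations) complex.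
From mathcomp Require Import -(notations) ssrcomplements.
From mathcomp Require Import zify ring lra.

Set Implicit Arguments.
Unset Strict Implicit.
Unset Printing Implicit Defensive.

Import Order.TTheory GRing.Theory Num.Theory.
Import numFieldNormedType.Exports.

Local Open Scope classical_set_scope.
Local Open Scope ring_scope.

(** * Real eigenvalues and Householder reflections *)

Section SymmetricMatrices.
Variable R : rcfType.

(** A complex eigenvalue exists because R[i] is algebraically closed; symmetry makes it real, and
    being an eigenvalue descends along the field extension. *)
Lemma symmetric_eigenvalue n (A : 'M[R]_n.+1) :
  A^T = A -> exists l, eigenvalue A l.
Proof.
move=> Asym; pose C : numClosedFieldType := complex.complex R.
pose f : {rmorphism R -> C} := @complex.real_complex_def R (Phant R).
have [l /eigenvalueP[v vA v0]] := @eigenvalue_closed C n.+1 (map_mx f A) isT.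
have fJ x : (f x)^* = f x by exact: complex.conjc_real.
pose w := map_mx Num.conj v.
have wA : w *m map_mx f A = l^* *: w.
  rewrite /w -map_mxZ -vA map_mxM -!map_mx_comp; congr (_ *m _).
  by apply/matrixP => i j; rewrite !mxE /= fJ.
have lJ : l^* = l.
  (* Both sides are v A w^T, with A acting on v or, by symmetry, on its conjugate w; the scalar v
     w^T is the squared norm of v. *)
  have : l *: (v *m w^T) = l^* *: (v *m w^T).
    rewrite scalemxAl -vA scalemxAr -linearZ/= -wA trmx_mul.
    by rewrite -mulmxA; congr (_ *m (_ *m _)); rewrite map_trmx Asym.
  have s0 : (v *m w^T) 0 0 != 0.
    have [i vi0] : exists i, v 0 i != 0 by apply/rV0Pn.
    rewrite mxE gt_eqF// (bigD1 i)//= ltr_pwDl//.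
      by rewrite !mxE -normCK exprn_gt0// normr_gt0.
    by apply: sumr_ge0 => j _; rewrite !mxE -normCK exprn_ge0.
  by move=> /matrixP/(_ 0 0); rewrite mxE [RHS]mxE => /(mulIf s0).
have : l \is Num.real by rewrite CrealE lJ.
move=> lr; exists (complex.Re l); rewrite -(eigenvalue_map f).
have -> : f (complex.Re l) = l by exact: complex.RRe_real.
by apply/eigenvalueP; exists v.
Qed.

(** [Q] is the reflection in the hyperplane orthogonal to [w], with [s] the squared norm of [w]. *)
Lemma reflection_involutive n (w : 'rV[R]_n) (s : R) :
    w *m w^T = s%:M -> s != 0 ->
  let Q := 1%:M - (2 / s) *: (w^T *m w) in Q *m Q = 1%:M.
Proof.
move=> ww s0 Q; rewrite /Q mulmxBl mul1mx mulmxBr mulmx1 -scalemxAl -scalemxAr.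
rewrite -mulmxA [w *m _]mulmxA ww mul_scalar_mx -scalemxAr !scalerA.
rewrite opprB -[RHS]addr0 -addrA; congr (_ + _).
rewrite -!scaleNr -!scalerDl [X in X *: _](_ : _ = 0) ?scale0r//.
by rewrite /GRing.scale/=; field.
Qed.

(** The reflection along v - e_0 exchanges the unit vectors e_0 and v. *)
Lemma householder n (v : 'rV[R]_(1 + n)) : v *m v^T = 1%:M ->
  exists Q : 'M[R]_(1 + n), [/\ Q^T = Q, Q *m Q = 1%:M & row 0 Q = v].
Proof.
move=> vv; pose e : 'rV[R]_(1 + n) := row 0 1%:M.
have [->|ve] := eqVneq v e.
  by exists 1%:M; split; rewrite ?trmx1 ?mul1mx.
pose w := v - e; pose s := (w *m w^T) 0 0.
have s0 : s != 0.
  have [i wi0] : exists i, w 0 i != 0 by apply/rV0Pn; rewrite subr_eq0.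
  rewrite gt_eqF// /s mxE (bigD1 i)//= ltr_pwDl//.
    by rewrite !mxE -expr2 exprn_even_gt0//=; rewrite !mxE in wi0.
  by apply: sumr_ge0 => j _; rewrite !mxE -expr2 sqr_ge0.
have ww : w *m w^T = s%:M by rewrite [LHS]mx11_scalar.
exists (1%:M - (2 / s) *: (w^T *m w)); split.
- by rewrite linearB/= trmx1 linearZ/= trmx_mul trmxK.
- exact: reflection_involutive.
- have ew : row 0 (w^T *m w) = w 0 0 *: w.
    rewrite row_mul; apply/rowP => j.
    by rewrite !mxE big_ord1 !mxE.
  rewrite linearB/= linearZ/= ew scalerA -/e.
  (* Since |v| = 1, |v - e_0|^2 = 2 - 2 v_0, so the coefficient of w in row 0 is exactly -1. *)
  have sE : s = - 2 * w 0 0.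
    have v1 : \sum_i v 0 i * v 0 i = 1.
      have /matrixP/(_ 0 0) := vv; rewrite [RHS]mxE eqxx mulr1n => <-.
      by rewrite mxE; apply: eq_bigr => i _; rewrite mxE.
    have w0 : w 0 0 = v 0 0 - 1 by rewrite !mxE eqxx.
    have wE i : i != 0 -> w 0 i = v 0 i.
      by move=> i0; rewrite !mxE eq_sym (negbTE i0) subr0.
    rewrite /s mxE (bigD1 0)//= [w^T 0 0]mxE w0.
    rewrite (eq_bigr (fun i => v 0 i * v 0 i)); last first.
      by move=> i i0; rewrite [w^T i 0]mxE wE.
    rewrite (bigD1 0)//= in v1; move: v1; set t := \sum_(i | _) _ => v1.
    by move: (v 0 0) t v1 => x t v1; lra.
  rewrite [_ * _](_ : _ = -1) ?scaleN1r ?opprK /w; first by rewrite addrC subrK.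
  rewrite sE; field; apply: contra s0 => /eqP w0; by rewrite sE w0 mulr0.
Qed.

End SymmetricMatrices.

(** * Orthogonal diagonalization of real symmetric matrices *)

Section SpectralTheorem.
Variable R : rcfType.

(** Deflation: conjugating by a Householder reflection that sends e_0 to a unit eigenvector splits
    off a 1 x 1 block, and the induction hypothesis diagonalizes the rest. *)
Theorem symmetric_spectral n (A : 'M[R]_n) : A^T = A ->
  exists (U : 'M[R]_n) (d : 'rV[R]_n), U *m U^T = 1%:M /\ A = U^T *m diag_mx d *m U.
Proof.
elim: n => [|n IH] in A *.
  by move=> _; exists 0, 0; rewrite !flatmx0; split; [|apply/flatmx0].
move: A; rewrite -[n.+1]add1n => A Asym.
have [l /eigenvalueP[u uA u0]] := @symmetric_eigenvalue R n A Asym.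
pose s := (u *m u^T) 0 0.
have s0 : 0 < s.
  have [i ui0] : exists i, u 0 i != 0 by apply/rV0Pn.
  rewrite /s mxE (bigD1 i)//= ltr_pwDl//.
    by rewrite !mxE -expr2 exprn_even_gt0.
  by apply: sumr_ge0 => j _; rewrite !mxE -expr2 sqr_ge0.
pose v := (Num.sqrt s)^-1 *: u.
have vA : v *m A = l *: v by rewrite -scalemxAl uA !scalerA mulrC.
have vv : v *m v^T = 1%:M.
  rewrite linearZ/= -scalemxAl -scalemxAr scalerA [u *m _]mx11_scalar -/s.
  rewrite scale_scalar_mx -invfM -expr2 sqr_sqrtr ?ltW// mulVf ?gt_eqF//.
have [Q [Qsym QQ Qv]] := @householder R n v vv.
have [B BA] : exists B : 'M[R]_(1 + n), B = Q *m A *m Q by exists (Q *m A *m Q).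
have Bsym : B^T = B by rewrite BA !trmx_mul Qsym Asym mulmxA.
have Brow : row 0 B = l *: row 0 1%:M.
  by rewrite BA !row_mul Qv vA -scalemxAl -Qv -row_mul QQ.
(* Row 0 of [B] is l e_0, and symmetry clears column 0 as well. *)
have BE : B = block_mx l%:M 0 0 (drsubmx B).
  have Bu : usubmx B = row_mx l%:M 0.
    apply/matrixP => i j; rewrite !ord1 -[LHS](_ : row 0 B 0 j = _).
      rewrite Brow !mxE; case: splitP => k jk; rewrite !mxE -val_eqE /= jk/=.
        by rewrite ord1 mulr1.
      by rewrite mulr0.
    by rewrite [LHS]mxE [RHS]mxE; congr (fun_of_matrix B _ _); apply/val_inj.
  rewrite -[LHS]submxK /ulsubmx /ursubmx Bu row_mxKl row_mxKr.
  rewrite [dlsubmx B](_ : _ = 0)// -[dlsubmx B]trmxK trmx_dlsub Bsym.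
  by rewrite /ursubmx Bu row_mxKr trmx0.
have /IH[U [d [UU dE]]] : (drsubmx B)^T = drsubmx B by rewrite trmx_drsub Bsym.
exists (block_mx 1%:M 0 0 U *m Q), (row_mx l%:M d); split.
  rewrite trmx_mul Qsym mulmxA -[_ *m Q *m Q]mulmxA QQ mulmx1.
  rewrite tr_block_mx mulmx_block !trmx0 trmx1 !mulmx0 !mul0mx mulmx1.
  by rewrite UU !addr0 add0r -scalar_mx_block.
rewrite trmx_mul Qsym tr_block_mx !trmx0 trmx1.
have -> : A = Q *m B *m Q.
  by rewrite BA !mulmxA QQ mul1mx -mulmxA QQ mulmx1.
rewrite BE !mulmxA; congr (_ *m _); rewrite -!mulmxA; congr (_ *m _).
rewrite diag_mx_row !mulmx_block !mul0mx !mulmx0 !addr0 !add0r ?mul0mx ?mulmx0.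
rewrite mul1mx mulmx1 mulmxA -dE; congr block_mx.
by apply/matrixP => i j; rewrite !ord1 !mxE.
Qed.

End SpectralTheorem.

(** * Functional calculus in an eigenbasis, and contractions *)

Section QuadraticForms.
Variable R : rcfType.

Definition qform n (A : 'M[R]_n) (v : 'cV[R]_n) : R := (v^T *m A *m v) 0 0.

(** The eigenvectors are the rows of [U]. Eigenvalues are kept as a function so that powers,
    products and exponentials act on [d] pointwise. *)
Definition spec_mx n (U : 'M[R]_n) (d : 'I_n -> R) : 'M[R]_n :=
  U^T *m diag_mx (\row_i d i) *m U.

Lemma symmetric_spec_mx n (A : 'M[R]_n) : A^T = A ->
  exists (U : 'M[R]_n) (d : 'I_n -> R), U *m U^T = 1%:M /\ A = spec_mx U d.
Proof.
move=> /symmetric_spectral[U [d [UU ->]]]; exists U, (d 0); split=> //.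
by congr (_ *m diag_mx _ *m _); apply/rowP => j; rewrite mxE.
Qed.

Lemma tr_spec_mx n (U : 'M[R]_n) d : (spec_mx U d)^T = spec_mx U d.
Proof. by rewrite /spec_mx !trmx_mul trmxK tr_diag_mx mulmxA. Qed.

Lemma spec_mxE n (U : 'M[R]_n) d a b :
  spec_mx U d a b = \sum_i U i a * d i * U i b.
Proof.
rewrite /spec_mx -mulmxA mxE; apply: eq_bigr => i _.
by rewrite mul_diag_mx !mxE mulrA.
Qed.

Lemma spec_mxM n (U : 'M[R]_n) d e : U *m U^T = 1%:M ->
  spec_mx U d *m spec_mx U e = spec_mx U (fun i => d i * e i).
Proof.
move=> UU; rewrite /spec_mx !mulmxA; congr (_ *m _).
rewrite -[_ *m U *m U^T]mulmxA UU mulmx1 -mulmxA mulmx_diag.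
by congr (_ *m diag_mx _); apply/rowP => i; rewrite !mxE.
Qed.

Lemma spec_mx1 n (U : 'M[R]_n) : U *m U^T = 1%:M ->
  spec_mx U (fun=> 1) = 1%:M.
Proof.
move=> UU; rewrite /spec_mx (_ : diag_mx _ = 1%:M).
  by rewrite mulmx1; apply: mulmx1C.
by apply/matrixP => i j; rewrite !mxE.
Qed.

Lemma spec_mxX n (U : 'M[R]_n) d j : U *m U^T = 1%:M ->
  spec_mx U d ^+ j = spec_mx U (fun i => d i ^+ j).
Proof.
move=> UU; elim: j => [|j IH].
  by rewrite expr0 -[LHS](spec_mx1 UU).
rewrite exprS IH -[_ * _]/(_ *m _) spec_mxM//.
by congr spec_mx; apply/funext => i; rewrite exprS.
Qed.

Lemma spec_mx_scalar n (U : 'M[R]_n) d c : U *m U^T = 1%:M ->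
  spec_mx U d + c%:M = spec_mx U (fun i => d i + c).
Proof.
move=> UU; rewrite -scalemx1 -(spec_mx1 UU) /spec_mx scalemxAl scalemxAr.
rewrite -mulmxDl -mulmxDr; congr (_ *m _ *m _); apply/matrixP => i j.
by rewrite !mxE; case: (i == j); rewrite ?(mulr1n, mulr0n, mulr0, mulr1, addr0).
Qed.

Lemma mxtrace_spec_mxM n (U : 'M[R]_n) d (B : 'M[R]_n) :
  \tr (spec_mx U d *m B) = \sum_i d i * qform B (row i U)^T.
Proof.
rewrite /spec_mx -!mulmxA mxtrace_mulC -!mulmxA; apply: eq_bigr => i _.
rewrite mul_diag_mx mxE [in LHS]mxE; congr (_ * _).
rewrite mulmxA /qform trmxK -row_mul [LHS]mxE [RHS]mxE.
by apply: eq_bigr => j _; congr (_ * _); rewrite !mxE.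
Qed.

Lemma mxtrace_spec_mx n (U : 'M[R]_n) d : U *m U^T = 1%:M ->
  \tr (spec_mx U d) = \sum_i d i.
Proof.
move=> UU; rewrite /spec_mx mxtrace_mulC mulmxA UU mul1mx mxtrace_diag.
by apply: eq_bigr => i _; rewrite mxE.
Qed.

Lemma qform1 n (v : 'cV[R]_n) : qform 1%:M v = \sum_i v i 0 ^+ 2.
Proof.
by rewrite /qform mulmx1 mxE; apply: eq_bigr => i _; rewrite mxE expr2.
Qed.

Lemma qform1_ge0 n (v : 'cV[R]_n) : 0 <= qform 1%:M v.
Proof. by rewrite qform1 sumr_ge0// => i _; rewrite sqr_ge0. Qed.

Lemma qform_spec n (U : 'M[R]_n) d v :
  qform (spec_mx U d) v = \sum_i d i * ((U *m v) i 0) ^+ 2.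
Proof.
rewrite /qform /spec_mx !mulmxA -mulmxA -trmx_mul -mulmxA mxE.
by apply: eq_bigr => i _; rewrite mul_diag_mx !mxE expr2 mulrCA !mulrA.
Qed.

Lemma qform1_isometry n (U : 'M[R]_n) v : U *m U^T = 1%:M ->
  qform 1%:M (U *m v) = qform 1%:M v.
Proof.
by move=> UU; rewrite /qform !mulmx1 trmx_mul mulmxA -[_ *m U]mulmxA
  (mulmx1C UU) mulmx1.
Qed.

Lemma qform1_row n (U : 'M[R]_n) i : U *m U^T = 1%:M ->
  qform 1%:M (row i U)^T = 1.
Proof.
move=> UU; rewrite /qform mulmx1 trmxK tr_row -row_mul.
have := congr1 (fun M : 'M[R]_n => M i i) UU; rewrite [RHS]mxE eqxx mulr1n => <-.
by rewrite !mxE; apply: eq_bigr => j _; rewrite !mxE.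
Qed.

Lemma qform_spec_row n (U : 'M[R]_n) d i : U *m U^T = 1%:M ->
  qform (spec_mx U d) (row i U)^T = d i.
Proof.
move=> UU; rewrite qform_spec (bigD1 i)//= tr_row.
have E j : (U *m col i U^T) j 0 = (j == i)%:R.
  have := congr1 (fun M : 'M[R]_n => M j i) UU; rewrite [RHS]mxE => <-.
  by rewrite !mxE; apply: eq_bigr => k _; rewrite !mxE.
rewrite E eqxx expr1n mulr1 big1 ?addr0// => j ji.
by rewrite E (negbTE ji) expr0n mulr0.
Qed.

Lemma qformZ n c (A : 'M[R]_n) v : qform (c *: A) v = c * qform A v.
Proof. by rewrite /qform -scalemxAr -scalemxAl mxE. Qed.

Lemma qformE n (A : 'M[R]_n) v :
  qform A v = \sum_i \sum_j A i j * (v i 0 * v j 0).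
Proof.
rewrite /qform mxE exchange_big/=; apply: eq_bigr => j _.
rewrite mxE mulr_suml; apply: eq_bigr => i _.
by rewrite !mxE -mulrA mulrCA.
Qed.

(** For symmetric [A], the bound on the quadratic form is equivalent to operator norm at most 1. *)
Definition contraction n (A : 'M[R]_n) :=
  A^T = A /\ forall v, `|qform A v| <= qform 1%:M v.

(** Testing on an eigenvector shows that each eigenvalue lies in [-1, 1]; hence so does its
    square. *)
Lemma contraction_sqr n (A : 'M[R]_n) : contraction A ->
  forall v, qform (A *m A) v <= qform 1%:M v.
Proof.
move=> [Asym Ac] v; have [U [d [UU AE]]] := symmetric_spec_mx Asym.
rewrite AE spec_mxM// qform_spec -(qform1_isometry _ UU) qform1.
apply: ler_sum => i _; rewrite ler_piMl ?sqr_ge0//.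
have := Ac (row i U)^T; rewrite qform1_row// AE qform_spec_row//.
by rewrite ler_norml => /andP[? ?]; nra.
Qed.

End QuadraticForms.

(** * Traces against positive semidefinite matrices *)

Section PositiveSemidefinite.
Variable R : realType.

Lemma psd_spec n (A : 'M[R]_n) : psd A -> exists (U : 'M[R]_n) (d : 'I_n -> R),
  [/\ U *m U^T = 1%:M, A = spec_mx U d & forall i, 0 <= d i].
Proof.
move=> [/symmetric_spec_mx[U [d [UU AE]]] A0]; exists U, d; split=> // i.
by rewrite -(qform_spec_row d i UU) -AE A0.
Qed.

Lemma psd_trace_ge0 n (A B : 'M[R]_n) : psd A -> psd B -> 0 <= \tr (A *m B).
Proof.
move=> /psd_spec[U [d [UU -> d0]]] [_ B0]; rewrite mxtrace_spec_mxM.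
by apply: sumr_ge0 => i _; rewrite mulr_ge0// /qform B0.
Qed.

Lemma spec_mx_psd n (U : 'M[R]_n) d : (forall i, 0 <= d i) -> psd (spec_mx U d).
Proof.
move=> d0; split=> [|v]; first exact: tr_spec_mx.
rewrite -/(qform _ _) qform_spec sumr_ge0// => i _.
by rewrite mulr_ge0 ?sqr_ge0.
Qed.

(** Expanding [G] in its eigenbasis, each nonnegative eigenvalue is multiplied by a Rayleigh
    quotient of [D], which is at least the smallest eigenvalue of [D]. *)
Lemma mxtrace_lambda_min n (G D : 'M[R]_n) : psd G -> D^T = D ->
  lambda_min D * \tr G <= \tr (G *m D).
Proof.
move=> /psd_spec[U [d [UU -> d0]]] /symmetric_spec_mx[V [e [VV DE]]].
have lee i : lambda_min D <= e i.
  apply: ge_inf => /=; last first.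
    apply/eigenvalueP; exists (row i V).
      rewrite DE /spec_mx !mulmxA -row_mul VV row1 -rowE row_diag_mx mxE.
      by rewrite -scalemxAl -rowE.
    apply/eqP => V0; have := qform1_row i VV; rewrite V0 qform1 big1 => [/esym/eqP|].
      by rewrite oner_eq0.
    by move=> j _; rewrite !mxE expr0n.
  (* An infimum is a lower bound only for a set bounded below; every eigenvalue is a Rayleigh
     quotient, hence at least this crude bound. *)
  exists (- \sum_j `|e j|) => l /eigenvalueP[v vD v0].
  have w0 : 0 < qform 1%:M v^T.
    rewrite lt_neqAle qform1_ge0 andbT eq_sym qform1 psumr_eq0; last first.
      by move=> j _; rewrite sqr_ge0.
    apply/allPn; have /rV0Pn[j vj] := v0; exists j; first exact: mem_index_enum.
    by rewrite mxE sqrf_eq0.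
  have vE : qform D v^T = l * qform 1%:M v^T.
    by rewrite /qform trmxK vD mulmx1 -scalemxAl mxE.
  have {vE} : - (\sum_j `|e j|) * qform 1%:M v^T <= l * qform 1%:M v^T.
    rewrite -vE DE qform_spec -(qform1_isometry _ VV) qform1 mulr_sumr.
    apply: ler_sum => j _; apply: ler_wpM2r; first by rewrite sqr_ge0.
    rewrite lerNl (le_trans (ler_norm _))// normrN (bigD1 j)//= lerDl.
    by apply: sumr_ge0.
  by rewrite ler_pM2r.
rewrite mxtrace_spec_mxM mxtrace_spec_mx// mulr_sumr.
apply: ler_sum => i _; rewrite mulrC ler_wpM2l//.
rewrite DE qform_spec -[lambda_min _]mulr1 -(qform1_row i UU).
rewrite -(qform1_isometry _ VV) qform1 mulr_sumr.
by apply: ler_sum => j _; rewrite ler_wpM2r ?sqr_ge0// -DE.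
Qed.

End PositiveSemidefinite.

(** * The exponential of a symmetric matrix and traces in two eigenbases *)

Section MatrixExponential.
Variable R : realType.

Lemma spec_mx_sum n (U : 'M[R]_n) d :
  spec_mx U d = \sum_i d i *: ((row i U)^T *m row i U).
Proof.
apply/matrixP => a b; rewrite spec_mxE summxE; apply: eq_bigr => i _.
by rewrite !mxE big_ord1 !mxE mulrCA mulrA.
Qed.

(** The partial sums are combinations of the fixed projections [E i] with scalar exponential partial
    sums as coefficients, so convergence is scalar. *)
Lemma expm_spec n (U : 'M[R]_n) d : U *m U^T = 1%:M ->
  expm (spec_mx U d) = spec_mx U (fun i => expR (d i)).
Proof.
move=> UU; rewrite /expm; apply: cvg_lim => //.
pose E i : 'M[R]_n := (row i U)^T *m row i U.
have -> : series (fun j => (j`!%:R)^-1 *: spec_mx U d ^+ j) =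
    (fun N => \sum_i series (exp_coeff (d i)) N *: E i).
  apply/funext => N; rewrite /series/=.
  under eq_bigr do rewrite spec_mxX// spec_mx_sum scaler_sumr.
  rewrite exchange_big/=; apply: eq_bigr => i _; rewrite scaler_suml.
  by apply: eq_bigr => j _; rewrite scalerA /exp_coeff mulrC.
rewrite spec_mx_sum; apply: cvg_big => [|i _]; first exact: add_continuous.
by apply: cvgZr_tmp; exact: is_cvg_series_exp_coeff.
Qed.

Lemma expm_psd n (A : 'M[R]_n) : A^T = A -> psd (expm A).
Proof.
move=> /symmetric_spec_mx[U [d [UU ->]]]; rewrite expm_spec//.
by apply: spec_mx_psd => i; exact: expR_ge0.
Qed.

Lemma trexp_gt0 n (A : 'M[R]_n.+1) : A^T = A -> 0 < \tr (expm A).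
Proof.
move=> /symmetric_spec_mx[U [d [UU ->]]]; rewrite expm_spec// mxtrace_spec_mx//.
rewrite big_ord_recl ltr_pwDl ?expR_gt0// sumr_ge0// => i _; exact: expR_ge0.
Qed.

Lemma expm0 n : expm (0 : 'M[R]_n) = 1%:M.
Proof.
have UU : 1%:M *m (1%:M)^T = 1%:M :> 'M[R]_n by rewrite trmx1 mulmx1.
have -> : 0 = spec_mx (1%:M : 'M[R]_n) (fun=> 0).
  by rewrite spec_mx_sum big1// => i _; rewrite scale0r.
rewrite expm_spec// expR0; exact: spec_mx1.
Qed.

Lemma expm_scalar n (A : 'M[R]_n) c : A^T = A ->
  expm (A + c%:M) = expR c *: expm A.
Proof.
move=> /symmetric_spec_mx[U [d [UU ->]]]; rewrite spec_mx_scalar// !expm_spec//.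
rewrite !spec_mx_sum scaler_sumr; apply: eq_bigr => i _.
by rewrite expRD scalerA mulrC.
Qed.

Lemma mxtrace_spec_spec n (U V : 'M[R]_n) d e :
  \tr (spec_mx U d *m spec_mx V e) =
  \sum_i \sum_j (V *m U^T) j i ^+ 2 * (d i * e j).
Proof.
rewrite mxtrace_spec_mxM; apply: eq_bigr => i _.
rewrite qform_spec mulr_sumr; apply: eq_bigr => j _.
have -> : (V *m (row i U)^T) j 0 = (V *m U^T) j i.
  by rewrite !mxE; apply: eq_bigr => k _; rewrite !mxE.
ring.
Qed.

(** The two cross terms of K^2 agree under the trace, by cyclicity and because the matrices diagonal
    in [U] commute. The column sums of the squared entries of V U^T are 1, which spreads the
    remaining term over j. *)
Lemma mxtrace_spec_sqr n (U V : 'M[R]_n) d e a :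
    U *m U^T = 1%:M -> V *m V^T = 1%:M ->
  let K := spec_mx V e - spec_mx U d in
  \tr (spec_mx U a *m (K *m K)) =
  \sum_i \sum_j (V *m U^T) j i ^+ 2 * (a i * (e j - d i) ^+ 2).
Proof.
move=> UU VV K; set W := V *m U^T.
have WW i : \sum_j W j i ^+ 2 = 1.
  have WW1 : W^T *m W = 1%:M.
    by rewrite trmx_mul trmxK mulmxA -[_ *m V]mulmxA (mulmx1C VV) mulmx1.
  have := congr1 (fun M : 'M[R]_n => M i i) WW1.
  rewrite [RHS]mxE eqxx mulr1n => <-; rewrite mxE.
  by apply: eq_bigr => j _; rewrite [in RHS]mxE expr2.
have -> : \tr (spec_mx U a *m (K *m K)) =
    \tr (spec_mx U a *m spec_mx V (fun j => e j * e j))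
    - \tr (spec_mx U (fun i => a i * d i) *m spec_mx V e) *+ 2
    + \tr (spec_mx U (fun i => a i * d i * d i)).
  have trE (S A D : 'M[R]_n) : \tr (S *m ((A - D) *m (A - D))) =
      \tr (S *m (A *m A)) - \tr (S *m (A *m D))
      - (\tr (S *m (D *m A)) - \tr (S *m (D *m D))).
    by rewrite mulmxBl !mulmxBr !raddfB.
  rewrite trE.
  rewrite [X in _ - X - _](_ : _ =
      \tr (spec_mx U (fun i => a i * d i) *m spec_mx V e)); last first.
    rewrite mulmxA mxtrace_mulC mulmxA spec_mxM//; congr (\tr (spec_mx U _ *m _)).
    by apply/funext => i; rewrite mulrC.
  rewrite [spec_mx U a *m (spec_mx U d *m spec_mx U d)]mulmxA !spec_mxM//.
  rewrite mulmxA spec_mxM//; ring.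
rewrite !mxtrace_spec_spec mxtrace_spec_mx// -sumrMnl -sumrB -big_split/=.
apply: eq_bigr => i _; rewrite -[X in _ + X]mul1r -(WW i) mulr_suml.
rewrite -sumrMnl -sumrB -big_split/=; apply: eq_bigr => j _.
rewrite -/W; ring.
Qed.

End MatrixExponential.

(** * Trace inequalities behind one Hamiltonian update *)

Section HamiltonianUpdates.
Variable R : realType.

(** From (1 - a) e^a <= 1 the left side is at most a (e^a - 1), which is at most a^2 e^a for a >= 0
    and at most a^2 for a <= 0. Multiplied by e^d, the factor 1 + e^a becomes symmetric in d and d +
    a. *)
Lemma expR_remainder_le (a : R) : expR a - 1 - a <= a ^+ 2 * (1 + expR a).
Proof.
have x0 := expR_gt0 a; have x1 := expR_ge1Dx a.
have x2 : (1 - a) * expR a <= 1.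
  by rewrite -[leRHS](mulVf (lt0r_neq0 x0)) -expRN ler_pM2r// expR_ge1Dx.
have [a0|a0] := leP 0 a; nra.
Qed.

(** With s = k^2 the hypothesis reads Z' (1 - s) <= Z (1 - k a + s); then 1 + x <= e^x bounds the
    right factor, and division by 1 - s costs e^(2s). *)
Lemma ln_growth_le (Z Z' a k : R) : 0 < Z -> 0 < Z' -> 0 <= k <= 4^-1 ->
    Z' <= Z - k * a * Z + k ^+ 2 * (Z + Z') ->
  ln Z' <= ln Z + (- k * a + 3 * k ^+ 2).
Proof.
move=> Z0 Z'0 /andP[k0 k1] step.
rewrite -ler_expR expRD !lnK ?posrE//.
rewrite (_ : _ + _ = (- k * a + k ^+ 2) + 2 * k ^+ 2); last by ring.
rewrite expRD mulrA.
have s0 : 0 <= k ^+ 2 by rewrite sqr_ge0.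
have s1 : k ^+ 2 <= 16^-1 by nra.
have E1 := expR_ge1Dx (- k * a + k ^+ 2); have E2 := expR_ge1Dx (2 * k ^+ 2).
move: (k ^+ 2) step E1 E2 s0 s1 => s step E1 E2 s0 s1.
have st : Z' * (1 - s) <= Z * (1 + (- k * a + s)) by lra.
(* (1 - s)(1 + 2s) = 1 + s (1 - 2s) >= 1 since s <= 1/2. *)
have F1 : Z' <= Z' * (1 - s) * (1 + 2 * s).
  have s2 : 0 <= 1 - 2 * s by lra.
  by have := mulr_ge0 (ltW Z'0) (mulr_ge0 s0 s2); lra.
apply: le_trans F1 _.
apply: (@le_trans _ _ (Z * expR (- k * a + s) * (1 + 2 * s))).
  rewrite ler_wpM2r//; first lra.
  by apply: le_trans st _; rewrite ler_wpM2l// ltW.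
by rewrite ler_wpM2l// mulr_ge0 ?expR_ge0// ltW.
Qed.

Lemma mxtrace_spec_mxM_le n (U : 'M[R]_n) a (B : 'M[R]_n) k :
    U *m U^T = 1%:M -> (forall i, 0 <= a i) ->
    (forall v, qform B v <= k * qform 1%:M v) ->
  \tr (spec_mx U a *m B) <= k * \tr (spec_mx U a).
Proof.
move=> UU a0 Bk; rewrite mxtrace_spec_mxM mxtrace_spec_mx// mulr_sumr.
apply: ler_sum => i _; rewrite mulrC ler_wpM2r//.
by rewrite (le_trans (Bk _))// qform1_row// mulr1.
Qed.

(* With eigenbases (u_i) of H and (v_j) of H', both sides are expectations
   under the doubly stochastic weights (u_i . v_j)^2, so the scalar bound
   applies termwise; this replaces the Golden-Thompson inequality. *)
Lemma trace_expm_step n (H H' : 'M[R]_n) k : H^T = H -> H'^T = H' ->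
    (forall v, qform ((H' - H) *m (H' - H)) v <= k * qform 1%:M v) ->
  \tr (expm H') <= \tr (expm H) + \tr (expm H *m (H' - H))
                   + k * (\tr (expm H) + \tr (expm H')).
Proof.
move=> /symmetric_spec_mx[U [d [UU ->]]] /symmetric_spec_mx[V [e [VV ->]]] Kk.
rewrite !expm_spec//; set a := fun i => expR (d i); set b := fun j => expR (e j).
set K := spec_mx V e - spec_mx U d.
rewrite -lerBlDl mulrDr -[leRHS]/(_ + _).
(* The error term is replaced by tr(e^H K^2) + tr(e^H' K^2), whose double sums match the scalar
   remainder bound. *)
have Ka := mxtrace_spec_mxM_le UU (fun i => expR_ge0 (d i)) Kk.
have Kb := mxtrace_spec_mxM_le VV (fun i => expR_ge0 (e i)) Kk.
apply: le_trans (lerD Ka Kb).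
have KN : K *m K = (spec_mx U d - spec_mx V e) *m (spec_mx U d - spec_mx V e).
  by rewrite -[_ - spec_mx V e]opprB mulNmx mulmxN opprK.
rewrite {2}KN !mxtrace_spec_sqr// mulmxBr raddfB/= spec_mxM//.
(* Writing the identity in the other eigenbasis turns traces of a single matrix into double sums
   with the same weights. *)
rewrite -[spec_mx V b]mul1mx -(spec_mx1 UU) -[spec_mx U a in X in _ - (X + _)]mulmx1.
rewrite -[spec_mx U (fun i => _ * _)]mulmx1 -(spec_mx1 VV).
rewrite !mxtrace_spec_spec [X in _ <= _ + X]exchange_big/=.
rewrite -!(sumrB, big_split)/=; apply: ler_sum => i _.
rewrite -!(sumrB, big_split)/=; apply: ler_sum => j _.
have -> : (U *m V^T) i j = (V *m U^T) j i.
  by rewrite -[U *m V^T]trmxK trmx_mul trmxK mxE.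
set q := _ ^+ 2; have q0 : 0 <= q by rewrite sqr_ge0.
have := expR_remainder_le (e j - d i).
have := expR_gt0 (d i); have : expR (e j) = expR (d i) * expR (e j - d i).
  by rewrite -expRD addrC subrK.
rewrite /a /b => -> di0; set x := expR (e j - d i) => h.
have := mulr_ge0 (mulr_ge0 q0 (ltW di0)) (etrans (subr_ge0 _ _) h).
rewrite -subr_ge0; congr (0 <= _); ring.
Qed.

(** The diagonal entries p_j of [X] in the eigenbasis of [H] form a probability vector, so sum (1 +
    e_j - c) p_j <= sum e^(e_j - c) = 1, using p_j <= 1; subtracting sum p_j = 1 gives the claim. *)
Lemma gibbs n (H X : 'M[R]_n.+1) : H^T = H -> psd X -> \tr X = 1 ->
  \tr (H *m X) <= ln (\tr (expm H)).
Proof.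
move=> Hsym X0 X1; have Z0 := trexp_gt0 Hsym; set c := ln _.
have [V [e [VV HE]]] := symmetric_spec_mx Hsym.
have pX : \sum_j qform X (row j V)^T = 1.
  rewrite -X1 -[X in \tr X]mul1mx -(spec_mx1 VV) mxtrace_spec_mxM.
  by apply: eq_bigr => j _; rewrite mul1r.
have p0 j : 0 <= qform X (row j V)^T by case: X0 => _; apply.
have p1 j : qform X (row j V)^T <= 1.
  by rewrite -pX (bigD1 j)//= lerDl sumr_ge0.
have e1 : \sum_j expR (e j - c) = 1.
  under eq_bigr do rewrite expRD.
  rewrite -mulr_suml expRN lnK ?posrE//.
  by rewrite HE expm_spec// mxtrace_spec_mx// mulfV// gt_eqF// -(mxtrace_spec_mx _ VV)
    -expm_spec// -HE.
rewrite HE mxtrace_spec_mxM -subr_ge0 -[c]mulr1 -pX mulr_sumr -sumrB.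
have : \sum_j (1 + (e j - c)) * qform X (row j V)^T <= 1.
  rewrite -[leRHS]e1; apply: ler_sum => j _.
  apply: (@le_trans _ _ (expR (e j - c) * qform X (row j V)^T)).
    by apply: ler_wpM2r => //; exact: expR_ge1Dx.
  by apply: ler_piMr => //; exact: expR_ge0.
move=> h; have := h; rewrite -[leRHS]pX -subr_ge0 -sumrB => /le_trans; apply.
by apply: ler_sum => j _; rewrite le_eqVlt; apply/orP; left; apply/eqP; ring.
Qed.

Lemma contraction_trace n (A X : 'M[R]_n) : contraction A -> psd X -> \tr X = 1 ->
  `|\tr (A *m X)| <= 1.
Proof.
move=> [_ A1] /psd_spec[U [x [UU -> x0]]]; rewrite mxtrace_spec_mx// => X1.
rewrite mxtrace_mulC mxtrace_spec_mxM (le_trans (ler_norm_sum _ _ _))// -[leRHS]X1.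
apply: ler_sum => i _; rewrite normrM ger0_norm// ler_piMr//.
by rewrite (le_trans (A1 _))// qform1_row.
Qed.

(** * The free energy argument for Hamiltonian updates *)

Section Soundness.
Variables (n : nat) (eps : R) (cs : seq ('M[R]_n.+1 * R)).
Hypothesis eps0 : 0 < eps.
Hypothesis cs_contr : forall c, c \in cs -> contraction c.1.

Definition gibbs_state (S : 'M[R]_n.+1) : 'M[R]_n.+1 := expm ((eps / 4) *: S).

Definition density (W : 'M[R]_n.+1) : 'M[R]_n.+1 := (\tr W)^-1 *: W.

Lemma density_gibbs_state S : S^T = S ->
  psd (density (gibbs_state S)) /\ \tr (density (gibbs_state S)) = 1.
Proof.
move=> Ssym; have Hsym : ((eps / 4) *: S)^T = (eps / 4) *: S by rewrite linearZ/= Ssym.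
have Z0 := trexp_gt0 Hsym; have [Wsym W0] := expm_psd Hsym.
split; last by rewrite /density linearZ/= mulVf// gt_eqF.
split; first by rewrite /density linearZ/= Wsym.
by move=> v; rewrite -/(qform _ _) qformZ mulr_ge0 ?invr_ge0 ?(ltW Z0)//; exact: W0.
Qed.

(** For a density matrix [X] this is the relative entropy of [X] to the Gibbs state plus the von
    Neumann entropy of [X], written without a matrix logarithm. *)
Definition free_energy (X S : 'M[R]_n.+1) : R :=
  ln (\tr (gibbs_state S)) - eps / 4 * \tr (S *m X).

Definition HU_shift (S A : 'M[R]_n.+1) := S + 2^-1 *: (1%:M - A).

Lemma HU_shift_sym S A : S^T = S -> A^T = A -> (HU_shift S A)^T = HU_shift S A.
Proof. by move=> Ss As; rewrite /HU_shift linearD linearZ/= linearB/= trmx1 Ss As. Qed.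

(** With k = eps/8, the change is at most -k (tr(A P) - tr(A X)) + 3 k^2. The violation makes the
    bracket exceed 8 k, so the drop exceeds 5 k^2 >= 4 k^2 = eps^2/16. *)
Lemma free_energy_drop X S c : psd X -> \tr X = 1 -> S^T = S -> c \in cs ->
    \tr (c.1 *m X) <= c.2 ->
    c.2 + eps < \tr (c.1 *m density (gibbs_state S)) ->
  free_energy X (HU_shift S c.1) + eps ^+ 2 / 16 < free_energy X S.
Proof.
move=> X0 X1 Ssym cc cX cP; have Ac := cs_contr cc; set A := c.1 in cX cP Ac *.
have [P0 P1] := density_gibbs_state Ssym.
have := contraction_trace Ac P0 P1; have := contraction_trace Ac X0 X1.
rewrite !ler_norml => /andP[AX1 AX2] /andP[AP1 AP2].
(* The exponent moves by (eps/4)(1/2)(1 - A) = k - k A; the scalar part shifts log-trace and energy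
   equally and cancels. *)
pose k := eps / 8; pose H := (eps / 4) *: S; pose H' := H - k *: A.
have Hsym : H^T = H by rewrite linearZ/= Ssym.
have Asym : A^T = A by case: Ac.
have H'sym : H'^T = H' by rewrite linearB/= Hsym linearZ/= Asym.
have Z0 := trexp_gt0 Hsym; have Z'0 := trexp_gt0 H'sym.
have HS : (eps / 4) *: HU_shift S A = H' + k%:M.
  rewrite /HU_shift /H' /H scalerDr scalerA scalerBr.
  rewrite (_ : eps / 4 * 2^-1 = k); last by rewrite /k; field.
  by rewrite scalemx1 addrA addrAC.
have a1 : \tr (A *m density (gibbs_state S)) = \tr (expm H *m A) / \tr (expm H).
  by rewrite /density -scalemxAr linearZ/= mxtrace_mulC mulrC.
have HK : H' - H = - (k *: A) by rewrite /H' addrAC subrr add0r.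
have Kk v : qform ((H' - H) *m (H' - H)) v <= k ^+ 2 * qform 1%:M v.
  rewrite HK mulNmx mulmxN opprK -scalemxAl -scalemxAr scalerA.
  by rewrite qformZ -expr2 ler_wpM2l ?sqr_ge0// contraction_sqr.
have := trace_expm_step Hsym H'sym Kk.
rewrite HK mulmxN -scalemxAr raddfN/= linearZ/=.
set Z := \tr (expm H) in Z0 a1 *; set Z' := \tr (expm H') in Z'0 *.
set a := \tr (A *m density _) in cP AP1 AP2 a1.
have -> : \tr (expm H *m A) = a * Z by rewrite a1 divfK// gt_eqF.
move=> step; have k0 : 0 < k by rewrite divr_gt0.
(* The violation gives eps < tr(A P) - tr(A X) <= 2. *)
have k1 : k <= 4^-1.
  have := le_lt_trans (lerD cX (lexx eps)) cP.
  move: (\tr (A *m X)) a AX1 AP2 {step cX cP a1 AX2 AP1} => w u AX1 AP2 wu.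
  by rewrite /k; lra.
have lnZ : ln Z' <= ln Z + (- k * a + 3 * k ^+ 2).
  by apply: ln_growth_le => //; [rewrite (ltW k0)|rewrite -mulrA].
rewrite /free_energy /gibbs_state HS expm_scalar// linearZ/= -/H -/Z -/Z'.
rewrite lnM ?posrE ?expR_gt0// expRK /HU_shift mulmxDl -scalemxAl mulmxBl mul1mx.
rewrite mxtraceD mxtraceZ raddfB/= X1.
have ek : eps = 8 * k by rewrite /k; field.
move: (\tr (S *m X)) (\tr (A *m X)) (ln Z) (ln Z') c.2 cX cP lnZ.
move=> x w z z' b cX; rewrite ek; clearbody k; clear -k0 cX => cP lnZ.
by have := ltr_pM2l k0 (b + 8 * k) a; nra.
Qed.

(** Rejection means that each remaining round made an update, hence a drop, and [gibbs] keeps the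
    final value nonnegative. Drops are strict, so the bound is strict as soon as a round remains. *)
Lemma HU_from_false X T S W eta : psd X -> \tr X = 1 ->
    (forall c, c \in cs -> \tr (c.1 *m X) <= c.2) ->
    HU_from eps cs T S W eta -> S^T = S -> W = gibbs_state S -> ~~ eta ->
  (if T is 0%N then 0 <= free_energy X S
   else T%:R * (eps ^+ 2 / 16) < free_energy X S).
Proof.
move=> X0 X1 Xc; elim => {T S W eta}; last first.
- move=> T S W c eta cc cW _ IH Ssym WE eta0.
  have Csym : c.1^T = c.1 by case: (cs_contr cc).
  have := IH (HU_shift_sym Ssym Csym) erefl eta0.
  rewrite WE in cW; have := free_energy_drop X0 X1 Ssym cc (Xc _ cc) cW.
  rewrite -/(HU_shift _ _).
  case: T {IH} => [|T] h1 h2; first by rewrite mul1r; lra.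
  by rewrite -[T.+2]addn1 natrD mulrDl mul1r; lra.
- by [].
- move=> S W Ssym _ _; rewrite /free_energy subr_ge0.
  have Hsym : ((eps / 4) *: S)^T = (eps / 4) *: S by rewrite linearZ/= Ssym.
  by have := gibbs Hsym X0 X1; rewrite -scalemxAl linearZ.
Qed.

Lemma ceil_nat_ge (x : R) : x <= (ceil_nat x)%:R.
Proof.
have [x0|x0] := leP x 0; first by rewrite (le_trans x0).
rewrite /ceil_nat; have := Num.Theory.ceil_ge x.
set z := Num.ceil x => zx; have z0 : 0 <= z.
  by rewrite -(ler_int R) (le_trans _ zx)// ltW.
by rewrite max_r// natr_absz ger0_norm.
Qed.

Lemma HU_feasible X eta : (0 < n)%N -> psd X -> \tr X = 1 ->
    (forall c, c \in cs -> \tr (c.1 *m X) <= c.2) ->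
  HU eps cs eta -> eta.
Proof.
move=> n0 X0 X1 Xc hu; apply/negPn/negP => eta0.
have W1 : 1%:M = gibbs_state 0 by rewrite /gibbs_state scaler0 expm0.
have := HU_from_false X0 X1 Xc hu (trmx0 _ _ _) W1 eta0.
have : 16 * ln n.+1%:R / eps ^+ 2 <= (ceil_nat (16 * ln n.+1%:R / eps ^+ 2))%:R :> R.
  exact: ceil_nat_ge.
(* A positive ln N forces at least one round; the strict bound then contradicts the initial free
   energy ln N. *)
have l0 : 0 < ln (n.+1%:R : R) by rewrite ln_gt0// ltr1n ltnS.
rewrite /free_energy mul0mx mxtrace0 mulr0 subr0 -W1 mxtrace1.
have e2 : 0 < eps ^+ 2 by rewrite exprn_gt0.
case: (ceil_nat _) => [|T].
  by rewrite pmulr_lle0 ?invr_gt0//; lra.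
rewrite ler_pdivrMr//; lra.
Qed.

(** Acceptance happens only at a round where no constraint is violated, and the current Gibbs state
    is the witness. *)
Lemma HU_from_true T S W eta : HU_from eps cs T S W eta ->
    S^T = S -> W = gibbs_state S -> eta ->
  exists P, [/\ psd P, \tr P = 1 &
                forall c, c \in cs -> \tr (c.1 *m P) <= c.2 + eps].
Proof.
elim => {T S W eta} [//|T S W cW Ssym WE _|T S W c eta cc _ _ IH Ssym _ eta1].
  by have [P0 P1] := density_gibbs_state Ssym; exists (density (gibbs_state S));
    split => // c cc; rewrite -WE cW.
apply: (IH _ erefl eta1); apply: HU_shift_sym => //.
by case: (cs_contr cc).
Qed.

Lemma HU_true : HU eps cs true ->
  exists P, [/\ psd P, \tr P = 1 &
                forall c, c \in cs -> \tr (c.1 *m P) <= c.2 + eps].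
Proof.
move=> /HU_from_true; apply=> //; first exact: trmx0.
by rewrite /gibbs_state scaler0 expm0.
Qed.

End Soundness.
End HamiltonianUpdates.

(** * Block-diagonal and padded matrices *)

Section BlockDiagonal.
Variable R : realType.

Lemma mxtrace_mxdiagM p (p_ : 'I_p -> nat) (D : forall i, 'M[R]_(p_ i))
    (B : 'M[R]_(\sum_i p_ i)) :
  \tr (\mxdiag_i D i *m B) = \sum_i \tr (D i *m submxblock B i i).
Proof.
rewrite -{1}[B]submxblockK mul_mxdiag_mxblock mxtrace_mxblock.
by apply: eq_bigr => i _.
Qed.

Lemma qform_mxdiag p (p_ : 'I_p -> nat) (D : forall i, 'M[R]_(p_ i)) v :
  qform (\mxdiag_i D i) v = \sum_i qform (D i) (submxcol v i).
Proof.
rewrite /qform -{1 2}[v]submxcolK tr_mxcol -mulmxA mul_mxdiag_mxcol.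
rewrite mul_mxrow_mxcol summxE; apply: eq_bigr => i _.
by rewrite -mulmxA.
Qed.

Lemma qform1_submxcol p (p_ : 'I_p -> nat) (v : 'cV[R]_(\sum_i p_ i)) :
  qform 1%:M v = \sum_i qform 1%:M (submxcol v i).
Proof. by rewrite -mxdiagZ qform_mxdiag. Qed.

Lemma contraction_mxdiag p (p_ : 'I_p -> nat) (D : forall i, 'M[R]_(p_ i)) :
  (forall i, contraction (D i)) -> contraction (\mxdiag_i D i).
Proof.
move=> Dc; split=> [|v].
  by rewrite tr_mxdiag; apply/eq_mxdiag => i; case: (Dc i).
rewrite qform_mxdiag qform1_submxcol (le_trans (ler_norm_sum _ _ _))//.
by apply: ler_sum => i _; case: (Dc i).
Qed.

Lemma psd_mxdiag p (p_ : 'I_p -> nat) (D : forall i, 'M[R]_(p_ i)) :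
  (forall i, psd (D i)) -> psd (\mxdiag_i D i).
Proof.
move=> Dp; split=> [|v].
  by rewrite tr_mxdiag; apply/eq_mxdiag => i; case: (Dp i).
rewrite -/(qform _ _) qform_mxdiag sumr_ge0// => i _.
by case: (Dp i) => _; apply.
Qed.

Lemma qform_pad n (B : 'M[R]_n) (v : 'cV[R]_(n + 1)) :
  qform (block_mx B 0 0 0) v = qform B (usubmx v).
Proof.
rewrite /qform -{1 2}[v]vsubmxK tr_col_mx mul_row_block.
by rewrite !mulmx0 !addr0 mul_row_col mul0mx addr0.
Qed.

Lemma contraction_pad n (B : 'M[R]_n) :
  contraction B -> contraction (block_mx B 0 0 0 : 'M[R]_(n + 1)).
Proof.
move=> [Bsym Bc]; split=> [|v]; first by rewrite tr_block_mx Bsym !trmx0.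
rewrite qform_pad (le_trans (Bc _))// !qform1 big_split_ord/=.
rewrite (eq_bigr (fun i => v (lshift 1 i) 0 ^+ 2)) => [|i _]; last by rewrite mxE.
by rewrite lerDl sumr_ge0// => i _; rewrite sqr_ge0.
Qed.

Lemma psd_pad n (B : 'M[R]_n) (c : R) : psd B -> 0 <= c ->
  psd (block_mx B 0 0 c%:M : 'M[R]_(n + 1)).
Proof.
move=> [Bsym B0] c0; split=> [|v].
  by rewrite tr_block_mx Bsym !trmx0 tr_scalar_mx.
rewrite -[v]vsubmxK tr_col_mx mul_row_block !mulmx0 addr0 add0r mul_row_col mxE.
rewrite addr_ge0 ?B0// mul_mx_scalar -scalemxAl mxE mulr_ge0//.
by rewrite mxE sumr_ge0// => i _; rewrite !mxE -expr2 sqr_ge0.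
Qed.

Lemma psd_ulsubmx n (P : 'M[R]_(n + 1)) : psd P -> psd (ulsubmx P).
Proof.
move=> [Psym P0]; split=> [|v]; first by rewrite trmx_ulsub Psym.
have := P0 (col_mx v 0); rewrite -{1}[P]submxK tr_col_mx mul_row_block.
by rewrite trmx0 !mul0mx !addr0 mul_row_col mulmx0 addr0.
Qed.

Lemma mxtrace_padM n (B : 'M[R]_n) (P : 'M[R]_(n + 1)) :
  \tr (block_mx B 0 0 0 *m P) = \tr (B *m ulsubmx P).
Proof.
rewrite -{1}[P]submxK mulmx_block !mul0mx !addr0 mxtrace_block mxtrace0 addr0.
by [].
Qed.

End BlockDiagonal.

(** * The Riesz functional and localizing matrices *)

Section RieszFunctional.
Variables (R : realType) (n : nat).
Implicit Types (p q : mpoly n R) (y : multinom n -> R).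

Lemma rieszE k y p : (msize p <= k)%N ->
  riesz y p = \sum_(be : bmultinom n k) mcoeff be p * y be.
Proof.
move=> pk; rewrite /riesz (big_mksub (bmultinom n k)) ?msupp_uniq//=; last first.
  by move=> x /msize_mdeg_lt /leq_trans; apply.
by rewrite big_rmcond//= => i /memN_msupp_eq0 ->; rewrite mul0r.
Qed.

Fact riesz_is_linear y : linear_for *%R (riesz y).
Proof.
move=> c p q; pose k := maxn (msize (c *: p + q)) (maxn (msize p) (msize q)).
rewrite !(@rieszE k) ?leq_max ?leqnn ?orbT// mulr_sumr -big_split/=.
by apply: eq_bigr => be _; rewrite mcoeffD mcoeffZ mulrDl mulrA.
Qed.

HB.instance Definition _ y :=
  GRing.isLinear.Build R (mpoly n R) R *%R (riesz y) (riesz_is_linear y).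

Lemma rieszX y be : riesz y (mpolyX R be) = y be.
Proof. by rewrite /riesz msuppX big_seq1 mcoeffX eqxx mul1r. Qed.

Lemma riesz1 y : riesz y 1 = y mnm0.
Proof. by rewrite -mpolyX0 rieszX. Qed.

Lemma rieszC y c : riesz y (@mpolyC n R c) = c * y mnm0.
Proof. by rewrite -[mpolyC n c]mulr1 mul_mpolyC linearZ/= riesz1. Qed.

Lemma rieszMX y p be :
  riesz y (p * mpolyX R be) = \sum_(ga <- msupp p) mcoeff ga p * y (mnm_add be ga).
Proof.
rewrite {1}[p]mpolyE mulr_suml linear_sum; apply: eq_bigr => ga _.
by rewrite -scalerAl linearZ/= -mpolyXD rieszX addmC.
Qed.

Lemma localizing_mxE t p y a b :
  localizing_mx t p y a b = riesz y (p * mpolyX R (mnm_add (exponent a) (exponent b))).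
Proof. by rewrite mxE rieszMX. Qed.

Lemma localizing_mx_sym t p y : (localizing_mx t p y)^T = localizing_mx t p y.
Proof. by apply/matrixP => a b; rewrite mxE !localizing_mxE addmC. Qed.

Lemma riesz_meval (x : n.-tuple R) p :
  riesz (fun be => meval (tnth x) (mpolyX R be)) p = meval (tnth x) p.
Proof.
by rewrite mevalE /riesz; apply: eq_bigr => be _; rewrite mevalX.
Qed.

(** The sequence whose Riesz functional reads off the coefficient of x^ga; it makes the matrices of
    CON instances of D_k(g y). *)
Definition indic_seq (ga : multinom n) : multinom n -> R := fun be => (be == ga)%:R.

Lemma riesz_indic ga p : riesz (indic_seq ga) p = mcoeff ga p.
Proof.
rewrite (@rieszE (maxn (msize p) (mdeg ga).+1)) ?leq_maxl//.
have gk : (mdeg ga < maxn (msize p) (mdeg ga).+1)%N by rewrite leq_maxr.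
rewrite (bigD1 (BMultinom gk))//= /indic_seq eqxx mulr1 big1 ?addr0// => be.
by rewrite bmeqP/= => /negbTE ->; rewrite mulr0.
Qed.

(** The duality between Gram matrices and moment sequences: both sides expand to the same sum over
    pairs of exponents. *)
Lemma riesz_quadratic y p t (A : 'M[R]_#|{: mons n t}|) :
  riesz y (p * ((vmon R n t)^T *m map_mx (@mpolyC n R) A *m vmon R n t) 0 0) =
  \tr (localizing_mx t p y *m A).
Proof.
rewrite !mxE mulr_sumr linear_sum/=; apply: eq_bigr => b _.
rewrite mxE !mxE mulr_suml mulr_sumr linear_sum/=; apply: eq_bigr => a _.
rewrite localizing_mxE !mxE.
rewrite mulrAC -mpolyXD mulrC -mulrA mulrCA mul_mpolyC.
by rewrite linearZ/= mulrC addmC [X in riesz _ X]mulrC.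
Qed.

Lemma localizing_mx_nonneg_quadratic y p t q :
  psd (localizing_mx t p y) -> (msize q <= t.+1)%N -> 0 <= riesz y (p * (q * q)).
Proof.
move=> [_ L0] qt; pose v : 'cV[R]_#|{: mons n t}| := \col_a mcoeff (exponent a) q.
have qE : q = \sum_a v a 0 *: mpolyX R (exponent a).
  rewrite {1}(mpolywE qt) (eq_bigl (mem {: mons n t}))//.
  by rewrite big_enum_val; apply: eq_bigr => a _; rewrite mxE.
have := L0 v; rewrite -/(qform _ _) qformE; congr (0 <= _).
rewrite {1}qE mulr_suml mulr_sumr linear_sum/=; apply: eq_bigr => a _.
rewrite {1}qE mulr_sumr mulr_sumr linear_sum/=; apply: eq_bigr => b _.
rewrite localizing_mxE -scalerAl -!scalerAr !linearZ/= -mpolyXD mulrA mulrC.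
by rewrite /GRing.scale/= mulrC.
Qed.

End RieszFunctional.

(** * Degree bounds and the coefficient norm *)

Section PolynomialSize.
Variables (R : realType) (n : nat).
Implicit Types p q : mpoly n R.

Lemma msizeM_pred p q : (msize (p * q) <= (msize p + msize q).-1)%N.
Proof.
have [->|p0] := eqVneq p 0; first by rewrite mul0r msize0.
have [->|q0] := eqVneq q 0; first by rewrite mulr0 msize0.
by rewrite msizeM.
Qed.

Lemma msize_hdeg p : (msize p <= (2 * hdeg p).+1)%N.
Proof.
rewrite /hdeg uphalf_half; have := odd_double_half (msize p).-1.
by rewrite -mul2n; case: (odd _); case: (msize p) => [|s] //=; lia.
Qed.

Lemma msize_linear : (msize (\sum_(j < n) mpolyX R (mnm1 j)) <= 2)%N.
Proof.
apply: leq_trans (msize_sum _ _ _) _; apply/bigmax_leqP => j _.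
by rewrite msizeX mdeg1.
Qed.

Lemma msizeX_linear t : (msize ((\sum_(j < n) mpolyX R (mnm1 j)) ^+ t) <= t.+1)%N.
Proof.
elim: t => [|t IH]; first by rewrite expr0 msize1.
rewrite exprS; apply: leq_trans (msizeM_pred _ _) _.
by have := msize_linear; move: IH; lia.
Qed.

Lemma l1norm_bmultinom t p : (msize p <= t)%N ->
  l1norm p = \sum_(be : bmultinom n t) `|mcoeff be p|.
Proof.
move=> pt; rewrite /l1norm (big_mksub (bmultinom n t)) ?msupp_uniq//=; last first.
  by move=> x /msize_mdeg_lt /leq_trans; apply.
by rewrite big_rmcond//= => i /memN_msupp_eq0 ->; rewrite normr0.
Qed.

End PolynomialSize.

(** * Norm bounds for the constraint blocks *)

Section HankelMatrices.
Variables (R : realType) (n : nat).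

Lemma exponent_inj t : injective (@exponent n t).
Proof. by move=> a b /val_inj/enum_val_inj. Qed.

(** Given alpha, at most one beta satisfies alpha + beta = eta. *)
Lemma hankel_unit_row_sum t eta (a : 'I_#|{: mons n t}|) :
  \sum_b hankel_unit R t eta a b <= 1.
Proof.
have [[b0 /eqP b0E]|nb] := pselect (exists b : 'I_#|{: mons n t}|,
    mnm_add (exponent a) (exponent b) == eta).
  rewrite (bigD1 b0)//= mxE b0E eqxx big1 ?addr0// => b bb0.
  rewrite mxE -b0E [_ == _](_ : _ = false)//; apply: contra_neqF bb0 => /eqP.
  by move/addmI/exponent_inj.
by rewrite big1// => b _; rewrite mxE; case: eqP => // E; case: nb; exists b; apply/eqP.
Qed.

Lemma hankel_unit_sym t eta : (hankel_unit R t eta)^T = hankel_unit R (n := n) t eta.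
Proof. by apply/matrixP => a b; rewrite !mxE addmC. Qed.

(** Schur test: |v_a v_b| <= (v_a^2 + v_b^2)/2, and row and column sums of this symmetric 0/1 matrix
    are at most 1. *)
Lemma hankel_unit_contraction t eta : contraction (hankel_unit R (n := n) t eta).
Proof.
split=> [|v]; first exact: hankel_unit_sym.
set h := hankel_unit _ _ _.
have h0 a b : 0 <= h a b by rewrite mxE ler0n.
pose T := \sum_a \sum_b h a b * (v a 0 ^+ 2).
have T1 : T <= qform 1%:M v.
  rewrite qform1; apply: ler_sum => a _; rewrite -mulr_suml ler_piMl ?sqr_ge0//.
  exact: hankel_unit_row_sum.
have TC : T = \sum_a \sum_b h a b * (v b 0 ^+ 2).
  rewrite /T exchange_big/=; apply: eq_bigr => a _; apply: eq_bigr => b _.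
  by rewrite -[h in LHS]hankel_unit_sym mxE.
apply: (le_trans _ T1); rewrite qformE.
have -> : T = \sum_a \sum_b h a b * ((v a 0 ^+ 2 + v b 0 ^+ 2) / 2).
  transitivity ((T + T) / 2); first by field.
  rewrite {1}TC {1}/T -big_split mulr_suml; apply: eq_bigr => a _.
  by rewrite -big_split mulr_suml; apply: eq_bigr => b _ /=; field.
rewrite (le_trans (ler_norm_sum _ _ _))//; apply: ler_sum => a _.
rewrite (le_trans (ler_norm_sum _ _ _))//; apply: ler_sum => b _.
rewrite normrM ger0_norm// ler_wpM2l// ler_norml.
move: (v a 0) (v b 0) => x z; have := sqr_ge0 (x - z); have := sqr_ge0 (x + z).
by rewrite !expr2 => ? ?; apply/andP; split; lra.
Qed.

Lemma contraction_comb N (I : finType) (P : pred I) (c : I -> R) (A : I -> 'M[R]_N) :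
    (forall i, contraction (A i)) -> \sum_(i | P i) `|c i| <= 1 ->
  contraction (\sum_(i | P i) c i *: A i).
Proof.
move=> Ac c1; split=> [|v].
  by rewrite linear_sum; apply: eq_bigr => i _; rewrite linearZ/=; case: (Ac i) => ->.
have -> : qform (\sum_(i | P i) c i *: A i) v = \sum_(i | P i) c i * qform (A i) v.
  rewrite /qform mulmx_sumr mulmx_suml summxE; apply: eq_bigr => i _.
  exact: qformZ.
rewrite (le_trans (ler_norm_sum _ _ _))//.
apply: (@le_trans _ _ (\sum_(i | P i) `|c i| * qform 1%:M v)).
  by apply: ler_sum => i _; rewrite normrM ler_wpM2l//; case: (Ac i).
by rewrite -mulr_suml ler_piMl ?qform1_ge0.
Qed.

(** The block is a combination of contractions weighted by coefficients of [p]; this is where the l1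
    normalization enters. *)
Lemma Bg_block_contraction t (p : mpoly n R) ga : l1norm p <= 1 ->
  contraction (\sum_(ze : mons n (2 * hdeg p) | lem ze ga)
      mcoeff ze p *: hankel_unit R t (mnm_sub ga ze)).
Proof.
move=> p1; apply: contraction_comb => [ze|]; first exact: hankel_unit_contraction.
apply: (le_trans _ p1); rewrite (l1norm_bmultinom (msize_hdeg p)) [leRHS](bigID (fun ze : mons n _ => lem ze ga))/=.
by rewrite lerDl sumr_ge0.
Qed.

(** For zeta <= gamma, alpha + beta = gamma - zeta means alpha + beta + zeta = gamma; for other zeta
    the indicator on the right vanishes. *)
Lemma Bg_blockE t (p : mpoly n R) ga :
  \sum_(ze : mons n (2 * hdeg p) | lem ze ga)
      mcoeff ze p *: hankel_unit R t (mnm_sub ga ze) =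
  localizing_mx t p (indic_seq R ga).
Proof.
apply/matrixP => a b; rewrite summxE mxE.
rewrite (big_mksub (mons n (2 * hdeg p))) ?msupp_uniq//=; last first.
  by move=> x /msize_mdeg_lt /leq_trans; apply; exact: msize_hdeg.
rewrite [RHS]big_rmcond/=; last by move=> ze /memN_msupp_eq0 ->; rewrite mul0r.
rewrite [LHS]big_mkcond/=; apply: eq_bigr => ze _; rewrite /indic_seq.
case: ifPn => [zega|zega]; last first.
  rewrite [_ == _](_ : _ = false) ?mulr0//; apply: contraNF zega => /eqP <-.
  exact: lem_addl.
rewrite !mxE; congr (_ * (nat_of_bool _)%:R); apply/idP/idP => /eqP E.
  by rewrite E submK.
by rewrite -E addmK.
Qed.

End HankelMatrices.

(** * Pairing the matrices of CON with certificates and moments *)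

Section CONMatrices.
Variables (R : realType) (n m : nat).
Variables (f : mpoly n R) (g : 'I_m.+1 -> mpoly n R) (k : nat).

Lemma BgE ga : Bg g k ga = Dmx g k (indic_seq R ga).
Proof. by apply/eq_mxdiag => i; rewrite Bg_blockE. Qed.

Lemma Dmx_sym y : (Dmx g k y)^T = Dmx g k y.
Proof.
by rewrite /Dmx tr_mxdiag; apply/eq_mxdiag => i; rewrite localizing_mx_sym.
Qed.

Lemma mxtrace_DmxM_mxdiag y (G : forall i, 'M[R]_(bsize g k i)) :
  \tr (Dmx g k y *m \mxdiag_(i < m.+1) G i) =
  riesz y (\sum_(i < m.+1) g i *
      ((vmon R n (k - hdeg (g i)))^T *m map_mx (@mpolyC n R) (G i)
         *m vmon R n (k - hdeg (g i))) 0 0).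
Proof.
rewrite mxtrace_mxdiagM linear_sum/=; apply: eq_bigr => i _.
by rewrite submxblock_diag riesz_quadratic.
Qed.

Hypothesis gk : forall i, (hdeg (g i) <= k)%N.

(** D_k(g y) is linear in y, namely the sum of the y_ga B_g^(ga) over |ga| <= 2k. *)
Lemma mxtrace_DmxM_Bg y (B : 'M[R]_(\sum_(i < m.+1) bsize g k i)) :
  \tr (Dmx g k y *m B) =
  \sum_(ga : mons n (2 * k)) y ga * \tr (Bg g k ga *m B).
Proof.
rewrite mxtrace_mxdiagM.
under [RHS]eq_bigr do rewrite BgE mxtrace_mxdiagM mulr_sumr.
rewrite exchange_big/=; apply: eq_bigr => i _.
move: (submxblock _ _ _) => {}B.
rewrite /mxtrace; under [RHS]eq_bigr do rewrite mulr_sumr.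
rewrite exchange_big/=; apply: eq_bigr => a _.
rewrite mxE; under [RHS]eq_bigr do rewrite mxE mulr_sumr.
rewrite exchange_big/=; apply: eq_bigr => b _.
under [RHS]eq_bigr do rewrite mulrA.
rewrite -mulr_suml; congr (_ * _); rewrite localizing_mxE.
(* The degree of x^(alpha+beta) g_i is at most 2 (k - d_i) + 2 d_i = 2k, where d_i <= k makes the
   truncated subtraction exact. *)
rewrite (@rieszE _ _ (2 * k).+1); last first.
  apply: leq_trans (msizeM_pred _ _) _; rewrite msizeX mdegD.
  have := msize_hdeg (g i); have := gk i.
  have := bmdeg (enum_val a); have := bmdeg (enum_val b).
  rewrite -!/(exponent _); lia.
by apply: eq_bigr => ga _; rewrite localizing_mxE riesz_indic mulrC.
Qed.

Lemma CON_mx_contraction ga : (forall i, l1norm (g i) <= 1) ->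
  contraction (CON_mx g k ga).
Proof.
move=> g1; apply: contraction_pad; apply: contraction_mxdiag => i.
exact: Bg_block_contraction.
Qed.

Definition sos_state (G : forall i, 'M[R]_(bsize g k i)) :
    'M[R]_(\sum_(i < m.+1) bsize g k i + 1) :=
  block_mx (\mxdiag_(i < m.+1) G i) 0 0 (1 - \tr (\mxdiag_(i < m.+1) G i))%:M.

Lemma sos_state_density l (G : forall i, 'M[R]_(bsize g k i)) : sos_feasible f l G ->
    \tr (\mxdiag_(i < m.+1) G i) <= 1 ->
  psd (sos_state G) /\ \tr (sos_state G) = 1.
Proof.
move=> [G0 _] G1; split; first by apply: psd_pad => //; rewrite subr_ge0.
by rewrite /sos_state mxtrace_block mxtrace_scalar mulr1n addrC subrK.
Qed.

(** Pairing the certificate with B_g^(ga) reads off a coefficient of f - l, and the slack entry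
    meets a zero block. *)
Lemma CON_mx_sos_state l (G : forall i, 'M[R]_(bsize g k i)) ga : sos_feasible f l G ->
  \tr (CON_mx g k ga *m sos_state G) = mcoeff ga f - l * (ga == mnm0)%:R.
Proof.
move=> [_ fl]; rewrite mxtrace_padM block_mxKul BgE mxtrace_DmxM_mxdiag -fl.
by rewrite riesz_indic mcoeffB mcoeffC.
Qed.

(** Evaluation at a feasible point is a moment sequence with positive semidefinite D_k, each block
    being g_i(a) >= 0 times a rank-one square. This places the initial lower end of the search
    correctly. *)
Lemma sos_lower_bound l (G : forall i, 'M[R]_(bsize g k i)) (a : n.-tuple R) : g ord0 = 1 ->
  sos_feasible f l G -> feasible_set g a -> l <= meval (tnth a) f.
Proof.
move=> g0 [G0 fl] fa; pose y be := meval (tnth a) (mpolyX R be).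
have : 0 <= \tr (Dmx g k y *m \mxdiag_(i < m.+1) G i).
  apply: psd_trace_ge0 => //; apply: psd_mxdiag => i.
  split; first exact: localizing_mx_sym.
  have gi0 : 0 <= meval (tnth a) (g i).
    by have [->|i0] := eqVneq i ord0; [rewrite g0 meval1|exact: fa].
  move=> v; rewrite -/(qform _ _) qformE.
  rewrite (_ : \sum_a _ = meval (tnth a) (g i) * (\sum_a v a 0 * y (exponent a)) ^+ 2).
    by rewrite mulr_ge0 ?sqr_ge0.
  rewrite expr2 mulr_suml mulr_sumr; apply: eq_bigr => b _.
  rewrite mulr_sumr mulr_sumr; apply: eq_bigr => c _.
  rewrite localizing_mxE riesz_meval mevalM mpolyXD mevalM /y; ring.
by rewrite mxtrace_DmxM_mxdiag -fl riesz_meval mevalB mevalC subr_ge0.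
Qed.

Lemma sos_trace_bound l (G : forall i, 'M[R]_(bsize g k i)) y : sos_feasible f l G ->
  lambda_min (Dmx g k y) * \tr (\mxdiag_(i < m.+1) G i) <=
  riesz y f - l * y mnm0.
Proof.
move=> [G0 fl]; apply: le_trans (mxtrace_lambda_min G0 (Dmx_sym y)) _.
by rewrite mxtrace_mulC mxtrace_DmxM_mxdiag -fl linearB/= rieszC.
Qed.

End CONMatrices.

(** * Bounding the l1 norm of a feasible moment sequence *)

Section MomentBound.
Variables (R : realType) (n m : nat).
Variables (g : 'I_m.+1 -> mpoly n R) (k : nat) (y : multinom n -> R).
Hypothesis g0 : g ord0 = 1.
Hypothesis y_feas : moment_feasible g k y.

Let s : mpoly n R := \sum_(j < n) mpolyX R (mnm1 j).

Lemma localizing_mx_psd i : psd (localizing_mx (k - hdeg (g i)) (g i) y).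
Proof.
have [_ M0 L0] := y_feas; have [->|] := eqVneq i ord0; last exact: L0.
rewrite g0 (_ : (k - hdeg (1%R : mpoly n R))%N = k); last by rewrite /hdeg msize1 subn0.
rewrite (_ : localizing_mx _ _ _ = moment_mx k y)//.
by apply/matrixP => a b; rewrite localizing_mxE mul1r rieszX mxE.
Qed.

Lemma Dmx_psd : psd (Dmx g k y).
Proof. by apply: psd_mxdiag => i; exact: localizing_mx_psd. Qed.

(** Writing be = 2h + al with al the parities of be, y_be is the diagonal entry at h of the
    localizing matrix of x^al, or of the moment matrix if al = 0. *)
Lemma moment_ge0 (ia : multinom n -> 'I_m.+1) be :
    (forall al : multinom n, (forall j, al j <= 1)%N -> al != mnm0 ->
       g (ia al) = mpolyX R al) ->
  (mdeg be <= 2 * k)%N -> 0 <= y be.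
Proof.
move=> gX bek.
pose al : multinom n := Multinom (mktuple (fun j => nat_of_bool (odd (be j)))).
pose hb : multinom n := Multinom (mktuple (fun j => (be j)./2)).
have beE : be = mnm_add (mnm_add hb hb) al.
  apply/mnmP => j; rewrite !mnmDE !mnmE addnn addnC.
  by rewrite odd_double_half.
have degE : mdeg be = (2 * mdeg hb + mdeg al)%N.
  by rewrite beE !mdegD; lia.
have [i [gi hi]] : exists i, g i = mpolyX R al /\ (mdeg hb <= k - hdeg (g i))%N.
  have [al0|al0] := eqVneq al mnm0.
    exists ord0; rewrite g0 al0 mpolyX0; split => //.
    by rewrite /hdeg msize1 subn0; lia.
  exists (ia al); rewrite gX//; last by move=> j; rewrite mnmE; case: odd.
  split=> //; rewrite /hdeg msizeX/= uphalf_half.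
  have := odd_double_half (mdeg al); rewrite -mul2n; case: (odd _); lia.
have := @localizing_mx_nonneg_quadratic _ _ y (g i) _ (mpolyX R hb)
  (localizing_mx_psd i).
rewrite msizeX ltnS => /(_ hi); rewrite gi -!mpolyXD rieszX.
by rewrite addmC -beE.
Qed.

(** Localizing r^2 - s^2 against the squares of s^j raises an even exponent by two; odd exponents
    take one last step with r - s. *)
Lemma riesz_power_le (r : R) i1 i2 c1 c2 : 0 < r ->
    0 < c1 -> g i1 = c1 *: (@mpolyC n R r - s) ->
    0 < c2 -> g i2 = c2 *: (@mpolyC n R (r ^+ 2) - s ^+ 2) ->
  forall t, (t <= 2 * k)%N -> riesz y (s ^+ t) <= r ^+ t.
Proof.
move=> r0 c10 g1 c20 g2.
have h1 : (hdeg (g i1) <= 1)%N.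
  have : (msize (g i1) <= 2)%N.
    rewrite g1 (leq_trans (msizeZ_le _ _))// (leq_trans (msizeD_le _ _))//.
    by rewrite geq_max msizeN msize_linear msizeC; case: eqP.
  by rewrite /hdeg; case: (msize _) => [|[|[|]]].
have h2 : (hdeg (g i2) <= 1)%N.
  have : (msize (g i2) <= 3)%N.
    rewrite g2 (leq_trans (msizeZ_le _ _))// (leq_trans (msizeD_le _ _))//.
    by rewrite geq_max msizeN (msizeX_linear R n 2) msizeC; case: eqP.
  by rewrite /hdeg; case: (msize _) => [|[|[|[|]]]].
(* Positivity of L_y((r^e - s^e) (s^j)^2), where [hdeg] at most 1 leaves room for degree j <= k -
   1. *)
have step e c i j : 0 < c -> g i = c *: (@mpolyC n R (r ^+ e) - s ^+ e) ->
    (hdeg (g i) <= 1)%N -> (j < k)%N ->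
    riesz y (s ^+ (2 * j + e)) <= r ^+ e * riesz y (s ^+ (2 * j)).
  move=> c0 gi hi jk; have := @localizing_mx_nonneg_quadratic _ _ y (g i) _ (s ^+ j)
    (localizing_mx_psd i).
  have sj : (msize (s ^+ j) <= (k - hdeg (g i)).+1)%N.
    by apply: leq_trans (msizeX_linear R n j) _; lia.
  move=> /(_ sj); rewrite gi -exprD addnn -mul2n -scalerAl linearZ/= pmulr_rge0//.
  by rewrite mulrBl mul_mpolyC linearB linearZ/= -exprD addnC subr_ge0.
have even j : (j <= k)%N -> riesz y (s ^+ (2 * j)) <= r ^+ (2 * j).
  elim: j => [_|j IH jk]; first by rewrite !expr0 riesz1; case: y_feas => ->.
  have := step 2%N _ _ _ c20 g2 h2 jk; rewrite mulnS addnC => /le_trans; apply.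
  by rewrite exprD ler_wpM2l ?exprn_ge0 ?(ltW r0)// IH// ltnW.
move=> t tk; have := odd_double_half t; rewrite -mul2n; case: (odd t) => /= tE; last first.
  by rewrite -tE add0n even//; lia.
rewrite -tE addnC; have jk : (t./2 < k)%N by lia.
have := step 1%N _ _ _ c10; rewrite !expr1 => /(_ _ _ g1 h1 jk) /le_trans; apply.
by rewrite addn1 exprS ler_wpM2l ?(ltW r0)// even// ltnW.
Qed.

Lemma mcoeffM_ge0 (p q : mpoly n R) :
    (forall ga, 0 <= mcoeff ga p) -> (forall ga, 0 <= mcoeff ga q) ->
  forall ga, 0 <= mcoeff ga (p * q).
Proof. by move=> p0 q0 ga; rewrite mcoeffM sumr_ge0// => i _; rewrite mulr_ge0. Qed.

Lemma mcoeff_sumX_ge0 (P : pred 'I_n) ga :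
  0 <= mcoeff ga (\sum_(j < n | P j) mpolyX R (mnm1 j)).
Proof. by rewrite linear_sum sumr_ge0// => j _; rewrite /= mcoeffX ler0n. Qed.

Lemma mcoeff_power_ge0 t ga : 0 <= mcoeff ga (s ^+ t).
Proof.
elim: t ga => [|t IH] ga; first by rewrite expr0 mcoeff1 ler0n.
by rewrite exprS; apply: mcoeffM_ge0 => // ga'; exact: mcoeff_sumX_ge0.
Qed.

(** The coefficient is a multinomial number. The induction removes a variable occurring in ga; the
    other variables contribute nonnegatively. *)
Lemma mcoeff_power_ge1 t ga : mdeg ga = t -> 1 <= mcoeff ga (s ^+ t).
Proof.
elim: t ga => [|t IH] ga gat.
  by rewrite expr0 mcoeff1 -mdeg_eq0 gat.
have [i gai] : exists i, ga i != 0%N.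
  apply/existsP; apply: contraPT gat; rewrite negb_exists => /forallP ga0.
  rewrite (_ : ga = mnm0) ?mdeg0//; apply/mnmP => i; rewrite mnm0E.
  by have := ga0 i; rewrite negbK => /eqP.
have gaE : ga = mnm_add (mnm1 i) (mnm_sub ga (mnm1 i)).
  by rewrite addmC submK// lep1mP.
have sE : s = mpolyX R (mnm1 i) + \sum_(j < n | j != i) mpolyX R (mnm1 j).
  by rewrite /s (bigD1 i).
rewrite exprSr {2}sE mulrDr mcoeffD ler_wpDr//.
  by apply: mcoeffM_ge0 => ga'; [exact: mcoeff_power_ge0|exact: mcoeff_sumX_ge0].
rewrite gaE mcoeffMX; apply: IH; apply/eqP.
by rewrite -(eqn_add2l 1) -(mdeg1 i) -mdegD -gaE gat mdeg1.
Qed.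

Lemma geometric_sum_le (r : R) N : 0 < r < 1 -> \sum_(t < N) r ^+ t.+1 <= r / (1 - r).
Proof.
move=> /andP[r0 r1]; have d0 : 0 < 1 - r by rewrite subr_gt0.
rewrite ler_pdivlMr//.
have -> : (\sum_(t < N) r ^+ t.+1) * (1 - r) = r - r ^+ N.+1.
  elim: N => [|N IH]; first by rewrite big_ord0 mul0r expr1 subrr.
  by rewrite big_ord_recr mulrDl IH/= !exprS; ring.
by rewrite lerBlDr lerDl exprn_ge0// ltW.
Qed.

(** As y >= 0 and x^ga occurs in s^|ga| with coefficient at least 1, the sum is at most that of
    L_y(s^t) over t = 1, ..., 2k, hence at most a geometric sum. *)
Lemma moment_sum_le (r : R) i1 i2 c1 c2 ia : 0 < r < 1 ->
    0 < c1 -> g i1 = c1 *: (@mpolyC n R r - s) ->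
    0 < c2 -> g i2 = c2 *: (@mpolyC n R (r ^+ 2) - s ^+ 2) ->
    (forall al : multinom n, (forall j, al j <= 1)%N -> al != mnm0 ->
       g (ia al) = mpolyX R al) ->
  \sum_(ga : mons n (2 * k) | bmnm ga != mnm0) `|y ga| <= r / (1 - r).
Proof.
move=> r01 c10 g1 c20 g2 gX; have r0 : 0 < r by case/andP: r01.
apply: le_trans (geometric_sum_le (2 * k) r01).
have y0 (ga : mons n (2 * k)) : 0 <= y ga.
  by apply: (moment_ge0 gX); rewrite -ltnS bmdeg.
apply: (@le_trans _ _ (\sum_(t < 2 * k) riesz y (s ^+ t.+1))); last first.
  by apply: ler_sum => t _; apply: (riesz_power_le r0 c10 g1 c20 g2).
have sE (t : 'I_(2 * k)) : riesz y (s ^+ t.+1) =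
    \sum_(ga : mons n (2 * k)) mcoeff ga (s ^+ t.+1) * y ga.
  by apply: rieszE; apply: leq_trans (msizeX_linear _ _ _) _; rewrite !ltnS.
rewrite (eq_bigr _ (fun t _ => sE t)).
rewrite exchange_big/= big_mkcond/=; apply: ler_sum => ga _.
have nn : 0 <= \sum_(t < 2 * k) mcoeff ga (s ^+ t.+1) * y ga.
  by rewrite sumr_ge0// => t _; rewrite mulr_ge0// mcoeff_power_ge0.
case: ifPn => // ga0; have dga : (mdeg ga).-1.+1 = mdeg ga.
  by rewrite prednK// lt0n mdeg_eq0.
have tk : ((mdeg ga).-1 < 2 * k)%N by rewrite dga -ltnS bmdeg.
(* Index t stands for the power t + 1, so the term kept for ga has index |ga| - 1. *)
rewrite (bigD1 (Ordinal tk))//= dga ler_wpDr//.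
  by rewrite sumr_ge0// => t _; rewrite mulr_ge0// mcoeff_power_ge0.
by rewrite ger0_norm// ler_peMl// mcoeff_power_ge1.
Qed.

End MomentBound.

(** * Integrals of polynomials through moments *)

Section PolynomialIntegral.
Variables (R : realType) (n : nat) (mu : {measure set (n.-tuple R) -> \bar R}).
Hypothesis int_mu : forall al : multinom n,
  mu.-integrable setT (fun x => (meval (tnth x) (mpolyX R al))%:E).

Lemma Rintegral_meval (p : mpoly n R) :
  \int[mu]_x meval (tnth x) p = riesz (moments mu) p.
Proof.
pose F (s : seq (multinom n)) (x : n.-tuple R) :=
  \sum_(al <- s) mcoeff al p * meval (tnth x) (mpolyX R al).
(* Integrability of the partial sums is carried through the induction because additivity of the
   integral requires it. *)
suff H s : mu.-integrable setT (EFin \o F s) /\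
    \int[mu]_x F s x = \sum_(al <- s) mcoeff al p * moments mu al.
  rewrite /riesz -(H _).2; apply: eq_Rintegral => x _.
  by rewrite mevalE; apply: eq_bigr => al _; rewrite mevalX.
elim: s => [|al s [IHi IH]].
  have -> : F [::] = cst 0 by apply/funext => x; rewrite /F big_nil.
  by rewrite big_nil Rintegral_cst// mul0r; split=> //; exact: integrable0.
pose h (x : n.-tuple R) := meval (tnth x) (mpolyX R al).
have -> : F (al :: s) = (fun x => mcoeff al p * h x + F s x).
  by apply/funext => x; rewrite /F big_cons.
have int_al : mu.-integrable setT (EFin \o (fun x => mcoeff al p * h x)).
  rewrite (_ : _ \o _ = (fun x => (mcoeff al p)%:E * (h x)%:E)%E)//.
  by apply: integrableZl => //; exact: int_mu.
rewrite big_cons RintegralD// RintegralZl// ?IH; last exact: int_mu.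
split => //; exact: (integrableD measurableT int_al IHi).
Qed.

Lemma moments0_ge0 : 0 <= moments mu mnm0.
Proof.
apply: Rintegral_ge0 => x _; rewrite mevalX big1// => j _.
by rewrite mnm0E expr0.
Qed.

End PolynomialIntegral.

(** * Invariants and termination width of the binary search *)

Section BinarySearch.
Variables (R : realType) (N : nat) (eps : R).
Variables (C : 'M[R]_N) (Ab : seq ('M[R]_N * R)).

Lemma contractionN (A : 'M[R]_N) : contraction A -> contraction (- A).
Proof.
move=> [As Ac]; split=> [|v]; first by rewrite linearN/= As.
by rewrite -scaleN1r qformZ mulN1r normrN.
Qed.

Lemma HU_feasible_gt1 (cs : seq ('M[R]_N * R)) X eta : (1 < N)%N -> 0 < eps ->
    (forall c, c \in cs -> contraction c.1) -> psd X -> \tr X = 1 ->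
    (forall c, c \in cs -> \tr (c.1 *m X) <= c.2) ->
  HU eps cs eta -> eta.
Proof.
case: N cs X => [//|N'] cs X N1 e0 cc X0 X1 Xc.
exact: (HU_feasible e0 cc N1 X0 X1 Xc).
Qed.

Lemma HU_true_gt0 (cs : seq ('M[R]_N * R)) : (0 < N)%N ->
    (forall c, c \in cs -> contraction c.1) -> HU eps cs true ->
  exists P, [/\ psd P, \tr P = 1 &
                forall c, c \in cs -> \tr (c.1 *m P) <= c.2 + eps].
Proof. by case: N cs => [//|N'] cs _; exact: HU_true. Qed.

(** The invariant is lo <= p and p - delta <= hi: a rejected level lies below p, an accepted one is
    at least p - delta, and each round halves the width. *)
Lemma BS_from_bounds (p delta : R) T lo hi out :
    (forall l eta, HU eps (BS_constraints C Ab l) eta -> p <= l -> eta) ->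
    (forall l, HU eps (BS_constraints C Ab l) true -> p - delta <= l) ->
    BS_from eps C Ab T lo hi out -> lo <= p -> p - delta <= hi ->
  out <= p /\ p - delta <= out + (hi - lo) / 2 ^+ T.
Proof.
move=> H1 H2; elim => {T lo hi out} [lo hi lop phi|T lo hi eta out hu _ IH lop phi].
  by rewrite expr0 divr1 [lo + _]addrC subrK.
have halve (x : R) : x / 2 ^+ T.+1 = x / 2 / 2 ^+ T by rewrite exprS invfM mulrA.
rewrite halve; case: eta hu IH => hu IH.
  have [oup pou] := IH lop (H2 _ hu); split=> //; move: pou.
  by rewrite (_ : (lo + hi) / 2 - lo = (hi - lo) / 2)//; field.
have lp : (lo + hi) / 2 <= p.
  by rewrite leNgt; apply/negP => /ltW /(H1 _ _ hu).
have [oup pou] := IH lp phi; split=> //; move: pou.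
by rewrite (_ : hi - (lo + hi) / 2 = (hi - lo) / 2)//; field.
Qed.

Lemma BS_bounds (p delta lo hi out : R) : 0 < eps -> lo < hi ->
    (forall l eta, HU eps (BS_constraints C Ab l) eta -> p <= l -> eta) ->
    (forall l, HU eps (BS_constraints C Ab l) true -> p - delta <= l) ->
    BS eps C Ab lo hi out -> lo <= p -> p - delta <= hi ->
  out <= p /\ p - delta <= out + eps.
Proof.
move=> e0 lohi H1 H2 /(BS_from_bounds H1 H2) H lop phi.
have [oup pou] := H lop phi; split=> //; apply: le_trans pou _.
rewrite lerD2l ler_pdivrMr ?exprn_gt0// mulrC -ler_pdivrMr//.
set x := (hi - lo) / eps; have x0 : 0 < x by rewrite divr_gt0 ?subr_gt0.
have l2 : 0 < ln (2 : R) by rewrite ln_gt0// ltr1n.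
(* The number of rounds gives 2^T >= (hi - lo)/eps, hence final width at most eps. *)
have := ceil_nat_ge (ln x / ln 2); rewrite -/x; set T := ceil_nat _.
by rewrite ler_pdivrMr// mulrC mulr_natr -lnXn// ler_ln// posrE exprn_gt0.
Qed.

End BinarySearch.

(** * Hamiltonian updates on the instances produced by CON *)

Section CONCorrectness.
Variables (R : realType) (n m : nat) (eps : R).
Variables (f : mpoly n R) (g : 'I_m.+1 -> mpoly n R) (k : nat).
Hypothesis eps0 : 0 < eps.
Hypothesis fk : (hdeg f <= k)%N.
Hypothesis gk : forall i, (hdeg (g i) <= k)%N.
Hypothesis g0 : g ord0 = 1.
Hypothesis g1 : forall i, l1norm (g i) <= 1.

Let CON_cs l := BS_constraints (CON_mx g k mnm0) (CON_constraints f g k) l.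

(** The block of g_0 contains the constant monomial and the padding adds one row, so that ln N >
    0. *)
Lemma CON_size : (1 < \sum_(i < m.+1) bsize g k i + 1)%N.
Proof.
rewrite addn1 ltnS (bigD1 ord0)//= addn_gt0; apply/orP; left.
have d0 : (mdeg (mnm0 (n := n)) < (k - hdeg (g ord0)).+1)%N by rewrite mdeg0.
by apply/card_gt0P; exists (BMultinom d0).
Qed.

Lemma CON_csP l c : c \in CON_cs l ->
  [\/ exists2 ga, ga != mnm0 & c = (CON_mx g k ga, mcoeff ga f),
      exists2 ga, ga != mnm0 & c = (- CON_mx g k ga, - mcoeff ga f) |
      c = (CON_mx g k mnm0, l)].
Proof.
have csP d : d \in CON_constraints f g k ->
    exists2 ga, ga != mnm0 & d = (CON_mx g k ga, mcoeff ga f).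
  by move=> /mapP[ga]; rewrite mem_filter => /andP[ga0 _] ->; exists (bmnm ga).
rewrite !mem_cat mem_seq1 => /or3P[/csP|/mapP[d /csP[ga ga0 ->] ->]|/eqP].
- by constructor 1.
- by constructor 2; exists ga.
- by constructor 3.
Qed.

Lemma CON_cs_contraction l c : c \in CON_cs l -> contraction c.1.
Proof.
by move=> /CON_csP[[ga _ ->]|[ga _ ->]|->]; try apply: contractionN;
  exact: CON_mx_contraction.
Qed.

Lemma CON_HU_feasible l (G : forall i, 'M[R]_(bsize g k i)) x eta :
    sos_feasible f l G -> \tr (\mxdiag_(i < m.+1) G i) <= 1 ->
    HU eps (CON_cs x) eta -> mcoeff mnm0 f - l <= x ->
  eta.
Proof.
move=> Gf G1 hu lx; have [X0 X1] := sos_state_density Gf G1.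
apply: (HU_feasible_gt1 CON_size eps0 (@CON_cs_contraction x) X0 X1) hu => c.
have cX ga := CON_mx_sos_state ga Gf.
move=> /CON_csP[[ga ga0 ->]|[ga ga0 ->]|->]/=.
- by rewrite cX (negbTE ga0) mulr0 subr0.
- by rewrite mulNmx raddfN/= cX (negbTE ga0) mulr0 subr0.
- by rewrite cX eqxx mulr1.
Qed.

Lemma CON_HU_true y B x : moment_feasible g k y ->
    \sum_(ga : mons n (2 * k) | bmnm ga != mnm0) `|y ga| <= B ->
    HU eps (CON_cs x) true ->
  mcoeff mnm0 f - riesz y f - eps * (1 + B) <= x.
Proof.
move=> yf yB hu; have [y0 _ _] := yf.
have [P [P0 _ Pc]] := HU_true_gt0 (ltnW CON_size) (@CON_cs_contraction x) hu.
pose t ga := \tr (CON_mx g k ga *m P).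
(* Each equality enters the constraints with both signs, so it holds up to eps in absolute value. *)
have Pt (ga : mons n (2 * k)) : bmnm ga != mnm0 ->
    `|t ga - mcoeff ga f| <= eps.
  move=> ga0; have inA : (CON_mx g k ga, mcoeff ga f) \in CON_constraints f g k.
    by apply/mapP; exists ga => //; rewrite mem_filter ga0 mem_enum.
  have c1 : t ga <= mcoeff ga f + eps.
    by apply: (Pc (_, _)); rewrite mem_cat inA.
  have c2 : - t ga <= - mcoeff ga f + eps.
    rewrite /t -raddfN/= -mulNmx; apply: (Pc (_, _)); rewrite !mem_cat.
    by rewrite (map_f (fun c : 'M[R]_(\sum_(i < m.+1) bsize g k i + 1) * R => (- c.1, - c.2)) inA) orbT.
  by rewrite ler_norml; apply/andP; split; lra.
have t0 : t mnm0 <= x + eps.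
  by apply: (Pc (_, _)); rewrite !mem_cat mem_seq1 eqxx !orbT.
have z0 : (mdeg (mnm0 (n := n)) < (2 * k).+1)%N by rewrite mdeg0.
have neq0 (ga : mons n (2 * k)) : (ga != BMultinom z0) = (bmnm ga != mnm0).
  by rewrite bmeqP.
(* This is tr(D_k(g y) P) >= 0, expanded over the constraint matrices. *)
have D0 : 0 <= \sum_(ga : mons n (2 * k)) y ga * t ga.
  have := psd_trace_ge0 (Dmx_psd g0 yf) (psd_ulsubmx P0).
  rewrite mxtrace_DmxM_Bg//; congr (0 <= _); apply: eq_bigr => ga _.
  by rewrite /t mxtrace_padM.
have fE : riesz y f = \sum_(ga : mons n (2 * k)) mcoeff ga f * y ga.
  apply: rieszE; apply: leq_trans (msize_hdeg f) _.
  by rewrite ltnS leq_mul2l fk orbT.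
rewrite (bigD1 (BMultinom z0))//= y0 mul1r (eq_bigl _ _ neq0) in D0.
rewrite (bigD1 (BMultinom z0))//= y0 mulr1 (eq_bigl _ _ neq0) in fE.
(* Replacing each trace by f_ga costs eps |y_ga|; the term ga = 0 is at most x + eps, which gives
   the 1 in 1 + B. *)
have S : \sum_(ga : mons n (2 * k) | bmnm ga != mnm0) y ga * t ga <=
    \sum_(ga : mons n (2 * k) | bmnm ga != mnm0) mcoeff ga f * y ga + eps * B.
  apply: (@le_trans _ _ (\sum_(ga : mons n (2 * k) | bmnm ga != mnm0)
      (mcoeff ga f * y ga + eps * `|y ga|))).
    apply: ler_sum => ga ga0; rewrite -lerBlDl [_ * y ga]mulrC -mulrBr.
    rewrite (le_trans (ler_norm _))// normrM mulrC ler_wpM2r//.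
    exact: Pt.
  by rewrite big_split/= -mulr_sumr lerD2l ler_wpM2l// ltW.
by rewrite fE; lra.
Qed.

End CONCorrectness.

(** * The error bound for CON *)

Theorem theorem4 (R : realType) (n m : nat) (eps : R)
    (f : mpoly n R) (g : 'I_m.+1 -> mpoly n R) (k : nat) (r : R)
    (i1 i2 : 'I_m.+1) (c1 c2 : R) (ia : multinom n -> 'I_m.+1)
    (lam : R) (mu : {measure set (n.-tuple R) -> \bar R})
    (a : n.-tuple R) (lam_eps : R) :
  0 < eps ->
  g ord0 = 1 ->
  (hdeg f <= k)%N ->
  (forall i, (hdeg (g i) <= k)%N) ->
  0 < r < 1 ->
  i1 != ord0 -> 0 < c1 ->
  g i1 = c1 *: (@mpolyC n R r - \sum_(j < n) mpolyX R (mnm1 j)) ->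
  i2 != ord0 -> 0 < c2 ->
  g i2 = c2 *: (@mpolyC n R (r ^+ 2) - (\sum_(j < n) mpolyX R (mnm1 j)) ^+ 2) ->
  (forall al : multinom n, (forall j, al j <= 1)%N -> al != mnm0 ->
     ia al != ord0 /\ g (ia al) = mpolyX R al) ->
  (lam%:E <= sos_value f g k)%E ->
  mu (~` feasible_set g) = 0%E ->
  (forall al : multinom n,
     mu.-integrable setT (fun x => (meval (tnth x) (mpolyX R al))%:E)) ->
  0 < lambda_min (Dmx g k (moments mu)) ->
  (\int[mu]_x (meval (tnth x) f - lam)) / lambda_min (Dmx g k (moments mu))
    <= 1 ->
  (forall i, i != ord0 -> l1norm (g i) <= 1) ->
  strong_duality f g k ->
  a \in feasible_set g ->
  CON_min f a < CON_max f lam ->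
  CON f g k eps lam a lam_eps ->
  (0 <= lam_eps%:E - sos_value f g k <= (eps * (2 + r / (1 - r)))%:E)%E.
Proof.
move=> eps0 g0 fk gk r01 _ c10 g1 _ c20 g2 gX lam_le _ int_mu Dmin muf gl1 sd.
rewrite inE => fa minmax [out bs ->].
have [dual [l [G [Gf lE]]] [y [yf yE]]] := sd.
have yl : riesz y f = l.
  by apply/EFin_inj; rewrite yE -dual -lE.
have gl i : l1norm (g i) <= 1.
  have [->|] := eqVneq i ord0; last exact: gl1.
  by rewrite g0 /l1norm msupp1 big_seq1 mcoeff1 eqxx normr1.
have lam_l : lam <= l by rewrite -lee_fin lE.
(* Since lam <= l and the mass of mu is nonnegative, the integral of f - l is at most that of f -
   lam, which (a) bounds by the smallest eigenvalue. *)
have G1 : \tr (\mxdiag_(i < m.+1) G i) <= 1.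
  rewrite -(ler_pM2l Dmin) mulr1; apply: le_trans (sos_trace_bound _ Gf) _.
  move: muf; rewrite ler_pdivrMr// mul1r; apply: le_trans.
  have -> : \int[mu]_x (meval (tnth x) f - lam) =
      \int[mu]_x meval (tnth x) (f - @mpolyC n R lam).
    by apply: eq_Rintegral => x _; rewrite mevalB mevalC.
  rewrite Rintegral_meval// linearB/= rieszC lerD2l lerN2.
  by rewrite ler_wpM2r// moments0_ge0.
have yB := moment_sum_le g0 yf r01 c10 g1 c20 g2
  (fun al al1 al0 => (gX al al1 al0).2).
have r0 : 0 <= r / (1 - r).
  by case/andP: r01 => r0 r1; rewrite divr_ge0 ?ltW// subr_gt0.
(* [delta] is the loss at an accepted level; the final width of the search adds one more eps, whence
   2 + r/(1 - r). *)
have [] := BS_bounds (p := mcoeff mnm0 f - l) (delta := eps * (1 + r / (1 - r)))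
  eps0 minmax _ _ bs.
- move=> x eta; exact: (CON_HU_feasible eps0 gl Gf G1).
- move=> x; rewrite -yl; exact: (CON_HU_true eps0 fk gk g0 gl yf yB).
- by rewrite lerD2l lerN2 (sos_lower_bound g0 Gf fa).
- have := mulr_ge0 (ltW eps0) (addr_ge0 ler01 r0).
  by rewrite /CON_max; lra.
move=> o1 o2; rewrite -lE -EFinB !lee_fin.
by apply/andP; split; lra.
Qed.
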